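(* Let $n\ge3$, $2\le i\le n-1$, $\mathfrak g=\mathfrak{sp}(n,\mathbb C)$, and $\mathfrak q=\mathfrak l\oplus\mathfrak n$ the maximal parabolic subalgebra of type $C_n(i)$. Let $V(\mu+\epsilon_\gamma)$ be the irreducible $\mathfrak l$-submodule of $\mathfrak l_\gamma\otimes\mathfrak z(\mathfrak n)$ of highest weight $\varepsilon_1+\varepsilon_2$. The $\Omega_2|_{V(\mu+\epsilon_\gamma)^*}$ system is conformally invariant on $\mathcal L_s$ if and only if $s=n-i+1$.
   Context: $\mathfrak g=\mathfrak{sp}(n,\mathbb C)$ (rank $n$) with Cartan $\mathfrak h$, roots $\pm\varepsilon_j\pm\varepsilon_k$ ($j<k$), $\pm2\varepsilon_j$, simple roots $\alpha_j=\varepsilon_j-\varepsilon_{j+1}$ ($j<n$), $\alpha_n=2\varepsilon_n$, Killing form $\kappa$, root vectors $X_\alpha$. $\mathfrak q=\mathfrak l\oplus\mathfrak n$ is the standard maximal parabolic subalgebra determined by $\alpha_{\mathfrak q}=\alpha_i$ with fundamental weight $\lambda_{\mathfrak q}=\lambda_i=\varepsilon_1+\dots+\varepsilon_i$; grading $\mathfrak g=\bigoplus_{j=-2}^2\mathfrak g(j)$ by the $\alpha_i$-coefficient, $\mathfrak l=\mathfrak g(0)$, $\Delta(\mathfrak g(1))=\{\varepsilon_j\pm\varepsilon_k:1\le j\le i<k\le n\}$, $\mathfrak z(\mathfrak n)=\mathfrak g(2)$ (roots $\varepsilon_j+\varepsilon_k$, $j<k\le i$, and $2\varepsilon_j$,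 $j\le i$), $\mathfrak n=\mathfrak g(1)\oplus\mathfrak g(2)$, $\bar{\mathfrak n}=\mathfrak g(-1)\oplus\mathfrak g(-2)$. $\mathfrak l_\gamma\cong\mathfrak{sl}(i,\mathbb C)$ is the simple ideal of $[\mathfrak l,\mathfrak l]$ with simple roots $\alpha_1,\dots,\alpha_{i-1}$. ($\mu=\varepsilon_1+\varepsilon_{i+1}$, $\epsilon_\gamma=\varepsilon_2-\varepsilon_{i+1}$.) Construction: $\omega=\sum_{\gamma\in\Delta(\mathfrak z(\mathfrak n))}X^*_\gamma\otimes X_\gamma$ ($X^*_\gamma\in\mathfrak g_{-\gamma}$ $\kappa$-dual), $\tau_2(X)=\tfrac12(\mathrm{ad}(X)^2\otimes\mathrm{Id})\omega$; for an irreducible constituent $W$ of $\mathfrak l\otimes\mathfrak z(\mathfrak n)$ and $Y^*\in W^*\subset\mathfrak l\otimes\mathfrak z(\bar{\mathfrak n})$ (via $\kappa$), $\tilde\tau_2(Y^* )(X)=Y^*(\tau_2(X))\in\mathcal P^2(\mathfrak g(1))\cong\mathrm{Sym}^2(\mathfrak g(-1))$ and $\omega_2(Y^* )=\sigma(\tilde\tau_2(Y^* ))\in\mathcal U(\bar{\mathfrak n})$, $\sigma(ab)=\tfrac12(ab+ba)$. The $\Omega_2|_{W^*}$ system is the system of operators $R(\omega_2(Y^* ))$ ($R$ infinitesimal right translation) on the line bundle $\mathcal L_s$ over $\bar N_0$ induced by the character of $Q_0$ with differential $s\lambda_{\mathfrak q}$. Let $\mathbb C_{-s}$ be the one-dimensional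 $\mathfrak q$-module of weight $-s\lambda_{\mathfrak q}$ with $[\mathfrak l,\mathfrak l]+\mathfrak n$ acting by $0$, and $1_{-s}$ the generator of $M_{\mathfrak q}[\mathbb C_{-s}]=\mathcal U(\mathfrak g)\otimes_{\mathcal U(\mathfrak q)}\mathbb C_{-s}$. The system is conformally invariant on $\mathcal L_s$ if and only if (Barchini–Kable–Zierau; may be taken as definition) $X\cdot(\omega_2(Y^* )\otimes1_{-s})=0$ for all $X\in\mathfrak n$, $Y^*\in W^*$. *)

(* Defs.v *)
(* Concrete model of g = sp(n, C) (C any numeric algebraically
   closed field, e.g. the complex numbers), its tensor algebra, the generalized
   Verma module M_q[C_{-s}] = T(g) / J_s, and the Omega_2 system. *)
From HB Require Import structures.
From mathcomp Require Import all_boot all_order all_algebra.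
Set Implicit Arguments. Unset Strict Implicit. Unset Printing Implicit Defensive.
Import Order.TTheory GRing.Theory Num.Theory.
Local Open Scope ring_scope.

(* Index set of the basis of sp(n): A-block entries (j,k) (Cartan when j = k,
   root e_j - e_k otherwise), B-block pairs j <= k (root e_j + e_k),
   C-block pairs j <= k (root -(e_j + e_k)).  Index j : 'I_n stands for e_{j+1}. *)
Notation symidx n := {p : 'I_n * 'I_n | (p.1 <= p.2)%N}.
Notation bidx n := (('I_n * 'I_n) + (symidx n + symidx n))%type.

(* sp(n,C) = { [[A, B], [C, -A^T]] : B, C symmetric } inside 'M_(2n). *)
Definition basisE (C : numClosedFieldType) (n : nat) (b : bidx n) : 'M[C]_(n + n) :=
  match b with
  | inl (j, k) => delta_mx (lshift n j) (lshift n k) - delta_mx (rshift n k) (rshift n j)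
  | inr (inl p) => delta_mx (lshift n (sval p).1) (rshift n (sval p).2)
                   + delta_mx (lshift n (sval p).2) (rshift n (sval p).1)
  | inr (inr p) => delta_mx (rshift n (sval p).1) (lshift n (sval p).2)
                   + delta_mx (rshift n (sval p).2) (lshift n (sval p).1)
  end.

Definition coordE (C : numClosedFieldType) (n : nat) (M : 'M[C]_(n + n)) (b : bidx n) : C :=
  match b with
  | inl (j, k) => M (lshift n j) (lshift n k)
  | inr (inl p) => if (sval p).1 == (sval p).2
                   then M (lshift n (sval p).1) (rshift n (sval p).1) / 2
                   else M (lshift n (sval p).1) (rshift n (sval p).2)
  | inr (inr p) => if (sval p).1 == (sval p).2
                   then M (rshift n (sval p).1) (lshift n (sval p).1) / 2
                   else M (rshift n (sval p).1) (lshift n (sval p).2)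
  end.

Definition ad (C : numClosedFieldType) (n : nat) (X Y : 'M[C]_(n + n)) : 'M[C]_(n + n) :=
  X *m Y - Y *m X.

Definition killing (C : numClosedFieldType) (n : nat) (X Y : 'M[C]_(n + n)) : C :=
  \sum_(b : bidx n) coordE (ad X (ad Y (basisE C b))) b.

Definition wt (n : nat) (b : bidx n) (l : 'I_n) : int :=
  match b with
  | inl (j, k) => (l == j)%:R - (l == k)%:R
  | inr (inl p) => (l == (sval p).1)%:R + (l == (sval p).2)%:R
  | inr (inr p) => - ((l == (sval p).1)%:R + (l == (sval p).2)%:R)
  end.

(* alpha_i-coefficient (grading degree) = pairing with e_1 + ... + e_i *)
Definition deg (n i : nat) (b : bidx n) : int := \sum_(l < n | (l < i)%N) wt b l.

Definition opp (n : nat) (b : bidx n) : bidx n :=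
  match b with
  | inl (j, k) => inl (k, j)
  | inr (inl p) => inr (inr p)
  | inr (inr p) => inr (inl p)
  end.

Definition dualvec (C : numClosedFieldType) (n : nat) (b : bidx n) : 'M[C]_(n + n) :=
  (killing (basisE C (opp b)) (basisE C b))^-1 *: basisE C (opp b).

(* negative root vectors of l (degree 0, negative root) *)
Definition negl (n i : nat) (b : bidx n) : bool :=
  (deg i b == 0) &&
  match b with inl (j, k) => (k < j)%N | inr (inl _) => false | inr (inr _) => true end.

(* tensors in g (x) g : t represents sum_{p,q} t p q E_p (x) E_q *)
Notation tens C n := (bidx n -> bidx n -> C).

Definition actT (C : numClosedFieldType) (n : nat) (Z : 'M[C]_(n + n)) (t : tens C n) : tens C n :=
  fun r q => \sum_(p : bidx n) coordE (ad Z (basisE C p)) r * t p q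
           + \sum_(p : bidx n) coordE (ad Z (basisE C p)) q * t r p.

(* lowest weight vectors of weight -(e_1+e_2) of l_gamma (x) z(nbar),
   l_gamma = sl(i) = trace-free upper-left i x i block of A *)
Definition lw_vec (C : numClosedFieldType) (n i : nat) (t : tens C n) : Prop :=
  [/\ (forall p q, t p q != 0 ->
         deg i q = - 2 /\ exists j k : 'I_n, [/\ p = inl (j, k), (j < i)%N & (k < i)%N]),
      (forall q, \sum_(j < n | (j < i)%N) t (inl (j, j)) q = 0),
      (forall (j : 'I_n) p q, actT (basisE C (inl (j, j))) t p q
                              = - (((j : nat) == 0%N)%:R + ((j : nat) == 1%N)%:R) * t p q)
    & (forall b, negl i b -> forall p q, actT (basisE C b) t p q = 0)].

(* W^* : the irreducible l-submodule of l (x) z(nbar) dual (via kappa) to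
   W = V(mu + eps_gamma) (highest weight e_1+e_2): generated under l by its
   lowest weight vectors of weight -(e_1+e_2). *)
Inductive inWdual (C : numClosedFieldType) (n i : nat) : tens C n -> Prop :=
  | Wd_lw t : lw_vec i t -> inWdual i t
  | Wd_add t1 t2 : inWdual i t1 -> inWdual i t2 ->
                   inWdual i (fun p q => t1 p q + t2 p q)
  | Wd_scale (a : C) t : inWdual i t -> inWdual i (fun p q => a * t p q)
  | Wd_act b t : deg i b = 0 -> inWdual i t -> inWdual i (actT (basisE C b) t)
  | Wd_ext t1 t2 : inWdual i t1 -> (forall p q, t1 p q = t2 p q) -> inWdual i t2.

Definition pairT (C : numClosedFieldType) (n : nat) (Y u : tens C n) : C :=
  \sum_(p : bidx n) \sum_(q : bidx n) \sum_(p' : bidx n) \sum_(q' : bidx n)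
    Y p q * u p' q' * killing (basisE C p) (basisE C p') * killing (basisE C q) (basisE C q').

(* tau_2(X) = 1/2 (ad(X)^2 (x) Id) omega,  omega = sum_{gamma in z(n)} X^*_gamma (x) X_gamma *)
Definition tau2 (C : numClosedFieldType) (n i : nat) (X : 'M[C]_(n + n)) : tens C n :=
  fun p q => 2^-1 * \sum_(g : bidx n | deg i g == 2)
                      coordE (ad X (ad X (dualvec C g))) p * (q == g)%:R.

Definition Qf (C : numClosedFieldType) (n i : nat) (Y : tens C n) (X : 'M[C]_(n + n)) : C :=
  pairT Y (tau2 i X).
Definition Bf (C : numClosedFieldType) (n i : nat) (Y : tens C n) (X1 X2 : 'M[C]_(n + n)) : C :=
  2^-1 * (Qf i Y (X1 + X2) - Qf i Y X1 - Qf i Y X2).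

(* tensor algebra T(g): functions on words in the basis (finitely supported) *)
Notation talg C n := (seq (bidx n) -> C).

(* omega_2(Ystar) = sigma(tilde tau_2(Ystar)), using P^2(g(1)) = Sym^2(g(-1)):
   x_a x_b  <->  F_a F_b  with F_a = X^*_a the kappa-dual of X_a in g(-1). *)
Definition omega2 (C : numClosedFieldType) (n i : nat) (Y : tens C n) : talg C n :=
  fun w => match w with
  | [:: p; q] =>
      \sum_(a : bidx n | deg i a == 1) \sum_(b : bidx n | deg i b == 1)
        Bf i Y (basisE C a) (basisE C b) *
        (2^-1 * (coordE (dualvec C a) p * coordE (dualvec C b) q
                 + coordE (dualvec C b) p * coordE (dualvec C a) q))
  | _ => 0
  end.

Definition lmulT (C : numClosedFieldType) (n : nat) (b : bidx n) (f : talg C n) : talg C n :=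
  fun w => if w is c :: w' then (c == b)%:R * f w' else 0.

(* the character of q with weight -s lambda_q, lambda_q = e_1+...+e_i,
   ([l,l] + n acting by 0), on basis vectors of q *)
Definition chi (C : numClosedFieldType) (n i : nat) (s : C) (b : bidx n) : C :=
  match b with
  | inl (j, k) => if (j == k) && (j < i)%N then - s else 0
  | _ => 0
  end.

(* J_s = kernel of T(g) -> U(g) (x)_{U(q)} C_{-s}:
   two-sided ideal of the Lie relations + left ideal generated by Y - chi(Y), Y in q *)
Inductive inJ (C : numClosedFieldType) (n i : nat) (s : C) : talg C n -> Prop :=
  | J0 : inJ i s (fun _ => 0)
  | JD f g : inJ i s f -> inJ i s g -> inJ i s (fun w => f w + g w)
  | JZ (a : C) f : inJ i s f -> inJ i s (fun w => a * f w)
  | Jext f g : inJ i s f -> (forall w, f w = g w) -> inJ i s g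
  | Jlie (a b : seq (bidx n)) (p q : bidx n) :
      inJ i s (fun w => (w == a ++ p :: q :: b)%:R - (w == a ++ q :: p :: b)%:R
                        - \sum_(r : bidx n) coordE (ad (basisE C p) (basisE C q)) r
                                            * (w == a ++ r :: b)%:R)
  | Jq (a : seq (bidx n)) (p : bidx n) : 0 <= deg i p ->
      inJ i s (fun w => (w == rcons a p)%:R - chi i s p * (w == a)%:R).

(* conformal invariance of the Omega_2|_{W^*} system on L_s:
   X . (omega_2(Ystar) (x) 1_{-s}) = 0 for all X in n, Y^* in W^* *)
Definition conf_invariant (C : numClosedFieldType) (n i : nat) (s : C) : Prop :=
  forall Y : tens C n, inWdual i Y ->
  forall x : bidx n -> C, (forall b, x b != 0 -> 1 <= deg i b) ->
  inJ i s (fun w => \sum_(b : bidx n) x b * lmulT b (omega2 i Y) w).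

(* Main.v *)
(** For X in g(1), the gl(i)-component of ad(X)^2 applied to an element N of g(-2) is
    (X X) N, and the upper right block of X X is the antisymmetric matrix of symplectic
    contractions of the rows of X.  Hence for every tensor Y in gl(i) (x) g(-2) the element
    omega_2(Y) is a combination of the symmetrised expressions
    sum_k (F_vk G_ck - F_ck G_vk), v, c <= i < k, where F_vk and G_ck are root vectors of
    roots -(e_v - e_k) and -(e_c + e_k).  Commuting X in g(1) through such an expression in
    the generalized Verma module gives 2 (n - i + 1 - s) times an element of g(-1), and X in
    g(2) gives zero by antisymmetry; this is the "if" part.  For the converse, an explicit
    lowest weight vector has a nonzero coefficient, and it remains to see that a nonzero
    element of g(-1) does not kill the canonical generator: sp(n) sits in gl(2n), which acts
    by twisted vector fields on the polynomial functions of an affine chart of the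
    Grassmannian of i-planes, and evaluating at the base point yields a functional on T(g)
    that vanishes on J_s but not on g(-1). *)

From HB Require Import structures.
From mathcomp Require Import all_boot all_order all_algebra.
From mathcomp Require Import ring mpoly.
Require Import Defs.
Set Implicit Arguments. Unset Strict Implicit. Unset Printing Implicit Defensive.
Import Order.TTheory GRing.Theory Num.Theory.
Local Open Scope ring_scope.

(** The ideal J_s is given by generators, so membership is shown by adding relations, whereas
    non-membership needs a linear form on T(g) that vanishes on every generator. Iterated
    differential operators evaluated at a point stabilised by q give such a form: the operators
    satisfy the bracket relations, and a last letter from q acts at that point by a scalar. All
    i-planes are used instead of the isotropic ones because isotropic planes satisfy quadratic
    equations in the chart, while all planes give a free polynomial ring on which gl(2n) acts by
    fields of the closed form X U - U X U.

    The value n - i + 1 has two sources. The double commutator of X with F_vk and G_ck contains a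
    term independent of k, and the n - i values of k add up equal copies of it. The other terms,
    from the double commutator and from the character, depend on k; after antisymmetrisation in v
    and c their sum over k is 1 - s further copies of the same element. *)

Section Symplectic.
Variables (C : numClosedFieldType) (n : nat).
Implicit Types (X Y M N : 'M[C]_(n + n)) (x y : 'I_(n + n)) (b p q : bidx n).

(** * The symplectic Lie algebra inside gl(2n) and coordinates in its basis *)

Definition flip x : 'I_(n + n) :=
  match split x with inl j => rshift n j | inr j => lshift n j end.

Definition sgn x : C := match split x with inl _ => 1 | inr _ => -1 end.

Lemma flipL (j : 'I_n) : flip (lshift n j) = rshift n j.
Proof. by rewrite /flip (unsplitK (inl j)). Qed.

Lemma flipR (j : 'I_n) : flip (rshift n j) = lshift n j.
Proof. by rewrite /flip (unsplitK (inr j)). Qed.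

Lemma sgnL (j : 'I_n) : sgn (lshift n j) = 1.
Proof. by rewrite /sgn (unsplitK (inl j)). Qed.

Lemma sgnR (j : 'I_n) : sgn (rshift n j) = -1.
Proof. by rewrite /sgn (unsplitK (inr j)). Qed.

Lemma flipK : involutive flip.
Proof. by move=> x; case: (split_ordP x) => j ->; rewrite ?flipL ?flipR ?flipL. Qed.

Lemma sgn_flip x : sgn (flip x) = - sgn x.
Proof.
by case: (split_ordP x) => j ->; rewrite ?flipL ?flipR ?sgnL ?sgnR ?opprK.
Qed.

Lemma sgn_sqr x : sgn x * sgn x = 1.
Proof. by case: (split_ordP x) => j ->; rewrite ?sgnL ?sgnR ?mulrNN mulr1. Qed.

(** Entrywise form of the condition that M is skew for the standard symplectic form: [flip]
    exchanges dual basis vectors and [sgn] records the signs of the form, so one formula covers all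
    four blocks. *)
Definition sympl M : Prop :=
  forall x y, M x y = - (sgn x * sgn y * M (flip y) (flip x)).

Lemma symplLR M (j k : 'I_n) : sympl M ->
  M (lshift n j) (rshift n k) = M (lshift n k) (rshift n j).
Proof. by move=> sM; rewrite sM flipL flipR sgnL sgnR; ring. Qed.

Lemma symplRL M (j k : 'I_n) : sympl M ->
  M (rshift n j) (lshift n k) = M (rshift n k) (lshift n j).
Proof. by move=> sM; rewrite sM flipL flipR sgnL sgnR; ring. Qed.

Lemma symplRR M (j k : 'I_n) : sympl M ->
  M (rshift n j) (rshift n k) = - M (lshift n k) (lshift n j).
Proof. by move=> sM; rewrite sM !flipR !sgnR; ring. Qed.

Lemma sympl_add M N : sympl M -> sympl N -> sympl (M + N).
Proof. by move=> sM sN x y; rewrite !mxE (sM x) (sN x); ring. Qed.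

Lemma sympl_scale (a : C) M : sympl M -> sympl (a *: M).
Proof. by move=> sM x y; rewrite !mxE (sM x); ring. Qed.

(** The symplectic adjoint reverses products and the minus signs of the two factors cancel. *)
Lemma sympl_mulE M N x y : sympl M -> sympl N ->
  (M *m N) x y = sgn x * sgn y * (N *m M) (flip y) (flip x).
Proof.
move=> sM sN; rewrite !mxE mulr_sumr [RHS](reindex_inj (inv_inj flipK)).
apply: eq_bigr => z _ /=; rewrite (sM x) (sN z).
rewrite -[RHS]mul1r -(sgn_sqr z); ring.
Qed.

Lemma sympl_ad X Y : sympl X -> sympl Y -> sympl (ad X Y).
Proof.
move=> sX sY x y; rewrite /ad [LHS]mxE [(- (Y *m X)) x y]mxE.
rewrite (sympl_mulE x y sX sY) (sympl_mulE x y sY sX).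
by rewrite [X in _ = - (_ * X)]mxE [(- (Y *m X)) _ _]mxE; ring.
Qed.

(* the projection of the elementary matrix to sp(n), up to the factor 2 *)
Definition sdelta x y : 'M[C]_(n + n) :=
  delta_mx x y - (sgn x * sgn y) *: delta_mx (flip y) (flip x).

Lemma flip_eq x y : (flip x == y) = (x == flip y).
Proof. by rewrite -(inj_eq (inv_inj flipK)) flipK. Qed.

Lemma sympl_sdelta x y : sympl (sdelta x y).
Proof.
move=> u v; rewrite !mxE !(inj_eq (inv_inj flipK)) !flip_eq.
rewrite [(v == y) && _]andbC [(v == flip x) && _]andbC.
have e1 : ((u == x) && (v == y))%:R
    = sgn u * sgn v * (sgn x * sgn y) * ((u == x) && (v == y))%:R :> C.
  case: eqP => [->|_] /=; last by rewrite mulr0.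
  case: eqP => [->|_] /=; last by rewrite mulr0.
  by rewrite mulr1 mulrACA !sgn_sqr mulr1.
have e2 : sgn x * sgn y * ((u == flip y) && (v == flip x))%:R
    = sgn u * sgn v * ((u == flip y) && (v == flip x))%:R.
  case: eqP => [->|_] /=; last by rewrite !mulr0.
  case: eqP => [->|_] /=; last by rewrite !mulr0.
  by rewrite !sgn_flip; ring.
by rewrite [in LHS]e1 e2; ring.
Qed.

Lemma sdeltaLL (j k : 'I_n) : sdelta (lshift n j) (lshift n k) = basisE C (inl (j, k)).
Proof. by rewrite /sdelta !sgnL !flipL mulr1 scale1r. Qed.

Lemma sdeltaLR (j k : 'I_n) : sdelta (lshift n j) (rshift n k)
  = delta_mx (lshift n j) (rshift n k) + delta_mx (lshift n k) (rshift n j).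
Proof. by rewrite /sdelta sgnL sgnR flipL flipR mul1r scaleN1r opprK. Qed.

Lemma sdeltaRL (j k : 'I_n) : sdelta (rshift n j) (lshift n k)
  = delta_mx (rshift n j) (lshift n k) + delta_mx (rshift n k) (lshift n j).
Proof. by rewrite /sdelta sgnL sgnR flipL flipR mulr1 scaleN1r opprK. Qed.

Lemma sdeltaRR (j k : 'I_n) : sdelta (rshift n j) (rshift n k) = - basisE C (inl (k, j)).
Proof. by rewrite /sdelta !sgnR !flipR mulrNN mulr1 scale1r opprB. Qed.

Lemma basisE_sdelta b : basisE C b = match b with
  | inl (j, k) => sdelta (lshift n j) (lshift n k)
  | inr (inl s) => sdelta (lshift n (sval s).1) (rshift n (sval s).2)
  | inr (inr s) => sdelta (rshift n (sval s).1) (lshift n (sval s).2)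
  end.
Proof.
by case: b => [[j k]|[s|s]]; rewrite ?sdeltaLL ?sdeltaLR ?sdeltaRL.
Qed.

Lemma sympl_basisE b : sympl (basisE C b).
Proof. rewrite basisE_sdelta; case: b => [[j k]|[s|s]]; exact: sympl_sdelta. Qed.

(** A basis vector at a pair j <= k is a sum of two elementary matrices that coincide when j = k.
    The weight 1/2 on the diagonal compensates for this, so sums over pairs become sums over a full
    block. *)
Lemma sum_symidx (f : 'I_n -> 'I_n -> C) :
  \sum_(s : symidx n) (if (sval s).1 == (sval s).2 then 2^-1 else 1) *
     (f (sval s).1 (sval s).2 + f (sval s).2 (sval s).1)
  = \sum_j \sum_k f j k.
Proof.
pose g (u : 'I_n * 'I_n) := (if u.1 == u.2 then 2^-1 else 1) * (f u.1 u.2 + f u.2 u.1).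
transitivity (\sum_(u : 'I_n * 'I_n | (u.1 <= u.2)%N) g u).
  by rewrite (big_sub (op := +%R) [pred u : 'I_n * 'I_n | (u.1 <= u.2)%N] g).
rewrite pair_big /= [RHS](bigID (fun u : 'I_n * 'I_n => u.1 == u.2)) /=.
rewrite (bigID (fun u : 'I_n * 'I_n => u.1 == u.2)) /=; congr (_ + _).
  apply: eq_big => [u|u /andP[_ /eqP e]].
    by case: eqP => [->|_]; rewrite ?leqnn // andbF.
  by rewrite /g e eqxx -mulr2n mulrnAr -mulrnAl -[2^-1 *+ 2]mulr_natr mulVf ?mul1r // pnatr_eq0.
transitivity (\sum_(u : 'I_n * 'I_n | (u.1 < u.2)%N) (f u.1 u.2 + f u.2 u.1)).
  apply: eq_big => [u|u /andP[_ ne]]; last by rewrite /g (negbTE ne) mul1r.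
  by rewrite [RHS]ltn_neqAle andbC.
rewrite big_split /= [RHS](bigID (fun u : 'I_n * 'I_n => (u.1 < u.2)%N)) /=.
congr (_ + _).
  by apply: eq_bigl => u; rewrite -val_eqE; case: ltngtP.
rewrite (reindex_inj (h := fun u : 'I_n * 'I_n => (u.2, u.1))) /=; last first.
  by case=> [a1 b1] [a2 b2] /= [-> ->].
by apply: eq_big => [u|u _] //=; rewrite -val_eqE; case: ltngtP.
Qed.

Lemma sum_bidx (V : nmodType) (F : bidx n -> V) :
  \sum_b F b = \sum_j \sum_k F (inl (j, k))
    + (\sum_(s : symidx n) F (inr (inl s)) + \sum_(s : symidx n) F (inr (inr s))).
Proof.
rewrite big_sumType /= big_sumType /= pair_big; congr (_ + _).
by apply: eq_bigr => -[].
Qed.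

Definition half_if (s : symidx n) : C := if (sval s).1 == (sval s).2 then 2^-1 else 1.

Lemma coordE_B M (s : symidx n) :
  coordE M (inr (inl s)) = half_if s * M (lshift n (sval s).1) (rshift n (sval s).2).
Proof. by rewrite /= /half_if; case: eqP => [->|_]; rewrite ?mul1r // mulrC. Qed.

Lemma coordE_C M (s : symidx n) :
  coordE M (inr (inr s)) = half_if s * M (rshift n (sval s).1) (lshift n (sval s).2).
Proof. by rewrite /= /half_if; case: eqP => [->|_]; rewrite ?mul1r // mulrC. Qed.

Lemma sum_delta (F : 'I_(n + n) -> 'I_(n + n) -> C) x y :
  \sum_u \sum_v F u v * (delta_mx u v : 'M[C]_(n + n)) x y = F x y.
Proof.
rewrite (bigD1 x) //= (bigD1 y) //= !mxE !eqxx mulr1 !big1 ?addr0 // => u ne.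
  by rewrite big1 // => v _; rewrite mxE eq_sym (negbTE ne) mulr0.
by rewrite mxE [y == u]eq_sym (negbTE ne) andbF mulr0.
Qed.

Lemma sympl_expand M : sympl M -> M = \sum_b coordE M b *: basisE C b.
Proof.
move=> sM; apply/matrixP => x y; rewrite summxE sum_bidx.
have -> : \sum_(s : symidx n) (coordE M (inr (inl s)) *: basisE C (inr (inl s))) x y
    = \sum_j \sum_k M (lshift n j) (rshift n k)
        * (delta_mx (lshift n j) (rshift n k) : 'M[C]_(n + n)) x y.
  rewrite -sum_symidx; apply: eq_bigr => s _.
  rewrite [LHS]mxE coordE_B /= [X in _ * X = _]mxE -/(half_if s).
  by rewrite (symplLR (sval s).2 _ sM); ring.
have -> : \sum_(s : symidx n) (coordE M (inr (inr s)) *: basisE C (inr (inr s))) x y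
    = \sum_j \sum_k M (rshift n j) (lshift n k)
        * (delta_mx (rshift n j) (lshift n k) : 'M[C]_(n + n)) x y.
  rewrite -sum_symidx; apply: eq_bigr => s _.
  rewrite [LHS]mxE coordE_C /= [X in _ * X = _]mxE -/(half_if s).
  by rewrite (symplRL (sval s).2 _ sM); ring.
(* Each A-block basis vector accounts for an entry of the upper left block and for the transposed
   entry, negated, of the lower right block. *)
have -> : \sum_j \sum_k (coordE M (inl (j, k)) *: basisE C (inl (j, k))) x y
    = \sum_j \sum_k M (lshift n j) (lshift n k)
        * (delta_mx (lshift n j) (lshift n k) : 'M[C]_(n + n)) x y
    + \sum_j \sum_k M (rshift n j) (rshift n k)
        * (delta_mx (rshift n j) (rshift n k) : 'M[C]_(n + n)) x y.
  rewrite [X in _ = _ + X]exchange_big -big_split; apply: eq_bigr => j _ /=.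
  rewrite -big_split; apply: eq_bigr => k _ /=.
  by rewrite (symplRR _ _ sM) [LHS]mxE /= [X in _ * X = _]mxE [(- delta_mx _ _) _ _]mxE; ring.
rewrite -[LHS](sum_delta (fun u v => M u v) x y) big_split_ord /=.
rewrite (eq_bigr _ (fun j _ => big_split_ord _ _ _)) big_split /=.
rewrite [X in _ + X = _](eq_bigr _ (fun j _ => big_split_ord _ _ _)) big_split /=.
by ring.
Qed.

Lemma coordED M N b : coordE (M + N) b = coordE M b + coordE N b.
Proof. by case: b => [[j k]|[s|s]]; rewrite ?coordE_B ?coordE_C /= !mxE ?mulrDr. Qed.

Lemma coordEZ (a : C) M b : coordE (a *: M) b = a * coordE M b.
Proof. by case: b => [[j k]|[s|s]]; rewrite ?coordE_B ?coordE_C /= !mxE // mulrCA. Qed.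

Lemma coordE0 b : coordE (0 : 'M[C]_(n + n)) b = 0.
Proof. by rewrite -(scale0r 0) coordEZ mul0r. Qed.

Lemma coordE_sum (I : Type) (r : seq I) (P : pred I) (F : I -> 'M[C]_(n + n)) b :
  coordE (\sum_(j <- r | P j) F j) b = \sum_(j <- r | P j) coordE (F j) b.
Proof. exact: (big_morph (fun M => coordE M b) (fun M N => coordED M N b) (coordE0 b)). Qed.

(** * The adjoint action, and the Killing form as a multiple of the trace form *)

Lemma ad_is_linear X : linear (ad X).
Proof.
by move=> a M N; rewrite /ad mulmxDr mulmxDl -scalemxAr -scalemxAl scalerBr opprD addrACA.
Qed.

HB.instance Definition _ X := GRing.isLinear.Build C _ _ *:%R _ (ad_is_linear X).

Lemma adZr (a : C) X M : ad X (a *: M) = a *: ad X M.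
Proof. exact: linearZ. Qed.

Lemma adZl (a : C) X M : ad (a *: X) M = a *: ad X M.
Proof. by rewrite /ad -scalemxAr -scalemxAl scalerBr. Qed.

Lemma ad_suml (I : Type) (r : seq I) (P : pred I) (F : I -> 'M[C]_(n + n)) M :
  ad (\sum_(j <- r | P j) F j) M = \sum_(j <- r | P j) ad (F j) M.
Proof. by rewrite /ad mulmx_suml mulmx_sumr -sumrB. Qed.

Lemma symidx_eqE (s t : symidx n) :
  (s == t) = ((sval s).1 == (sval t).1) && ((sval s).2 == (sval t).2).
Proof. by rewrite -val_eqE -xpair_eqE; case: s t => -[a c] ? [[u v] ?]. Qed.

Lemma coord_sdelta_sym (s t : symidx n) : half_if s *
    (((sval s).1 == (sval t).1) && ((sval s).2 == (sval t).2))%:R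
  + half_if s * (((sval s).1 == (sval t).2) && ((sval s).2 == (sval t).1))%:R
  = (t == s)%:R.
Proof.
rewrite [t == s]eq_sym symidx_eqE /half_if; case: s t => -[a c] /= ac [[u v] /= uv].
have [<-|ne] := eqVneq a c.
  rewrite [(a == v) && _]andbC; case: (_ && _);
    rewrite ?mulr0n ?mulr1n; by field.
rewrite !mul1r; case: (eqVneq a v) => [ev|_]; rewrite ?addr0 //.
case: (eqVneq c u) => [eu|_] /=; rewrite ?andbF ?addr0 //.
by case/eqP: ne; apply/val_inj/eqP; rewrite /= eqn_leq ac /= eu ev.
Qed.

Lemma coordE_basisE b p : coordE (basisE C b) p = (b == p)%:R.
Proof.
case: p => [[j k]|[s|s]]; case: b => [[u v]|[t|t]]; rewrite ?coordE_B ?coordE_C /= !mxE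
  ?eq_lshift ?eq_rshift ?eq_lrshift ?eq_rlshift ?andbF ?subr0 ?addr0 ?mulr0 //=.
- by rewrite [j == _]eq_sym [k == _]eq_sym.
- by rewrite mulrDr; exact: coord_sdelta_sym.
- by rewrite mulrDr; exact: coord_sdelta_sym.
Qed.

(** Half of [sdelta] is the projection of gl(2n) onto sp(n), so the trace of T on sp(n) is the trace
    on gl(2n) of T composed with this projection, which elementary matrices compute. *)
Lemma sum_coordE_sdelta (T : {linear 'M[C]_(n + n) -> 'M[C]_(n + n)}) :
  (forall M, sympl M -> sympl (T M)) ->
  \sum_b coordE (T (basisE C b)) b = 2^-1 * \sum_x \sum_y T (sdelta x y) x y.
Proof.
move=> sT; rewrite sum_bidx.
have -> : \sum_j \sum_k coordE (T (basisE C (inl (j, k)))) (inl (j, k))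
     = \sum_j \sum_k T (sdelta (lshift n j) (lshift n k)) (lshift n j) (lshift n k).
  by apply: eq_bigr => j _; apply: eq_bigr => k _; rewrite sdeltaLL.
rewrite big_split_ord /=.
rewrite (eq_bigr _ (fun j _ => big_split_ord _ _ _)) big_split /=.
rewrite [X in _ = _ * (_ + X)](eq_bigr _ (fun j _ => big_split_ord _ _ _)) big_split /=.
have -> : \sum_j \sum_k T (sdelta (rshift n j) (rshift n k)) (rshift n j) (rshift n k)
     = \sum_j \sum_k T (sdelta (lshift n j) (lshift n k)) (lshift n j) (lshift n k).
  rewrite exchange_big; apply: eq_bigr => j _; apply: eq_bigr => k _.
  rewrite sdeltaRR linearN mxE sdeltaLL (symplRR k j (sT _ (sympl_basisE _))).
  by rewrite opprK.
have -> : \sum_(s : symidx n) coordE (T (basisE C (inr (inl s)))) (inr (inl s))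
    = 2^-1 * \sum_j \sum_k T (sdelta (lshift n j) (rshift n k)) (lshift n j) (rshift n k).
  rewrite -sum_symidx mulr_sumr; apply: eq_bigr => s _; rewrite coordE_B -/(half_if s).
  rewrite [sdelta (lshift n (sval s).2) _]sdeltaLR [X in T X _ _ + _]sdeltaLR.
  rewrite [delta_mx (lshift n (sval s).2) _ + _]addrC.
  rewrite [X in _ * (_ * (_ + X))]symplLR; last exact: (sT _ (sympl_basisE (inr (inl s)))).
  by field.
have -> : \sum_(s : symidx n) coordE (T (basisE C (inr (inr s)))) (inr (inr s))
    = 2^-1 * \sum_j \sum_k T (sdelta (rshift n j) (lshift n k)) (rshift n j) (lshift n k).
  rewrite -sum_symidx mulr_sumr; apply: eq_bigr => s _; rewrite coordE_C -/(half_if s).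
  rewrite [sdelta (rshift n (sval s).2) _]sdeltaRL [X in T X _ _ + _]sdeltaRL.
  rewrite [delta_mx (rshift n (sval s).2) _ + _]addrC.
  rewrite [X in _ * (_ * (_ + X))]symplRL; last exact: (sT _ (sympl_basisE (inr (inr s)))).
  by field.
by field.
Qed.

Lemma mulmx_delta_mulmx M x y N u v :
  (M *m delta_mx x y *m N) u v = M u x * N y v.
Proof.
rewrite mxE (bigD1 y) //= big1 ?addr0 => [|z zy]; rewrite mxE.
  rewrite (bigD1 x) //= big1 ?addr0 => [|z zx]; rewrite mxE ?eqxx ?mulr1 //.
  by rewrite (negbTE zx) mulr0.
by rewrite big1 ?mul0r // => w _; rewrite mxE (negbTE zy) andbF mulr0.
Qed.

(** The trace of Z -> M Z N after projection: an ordinary trace and a term twisted by the symplectic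
    transpose. The next three lemmas evaluate the twisted term when a factor is symplectic or the
    identity. *)
Lemma sum_mulmx_sdelta M N :
  \sum_x \sum_y (M *m sdelta x y *m N) x y
  = \tr M * \tr N - \sum_x \sum_y sgn x * sgn y * (M x (flip y) * N (flip x) y).
Proof.
rewrite /mxtrace mulr_suml -sumrB; apply: eq_bigr => x _.
rewrite mulr_sumr -sumrB; apply: eq_bigr => y _.
rewrite mulmxBr mulmxBl -scalemxAr -scalemxAl [LHS]mxE mulmx_delta_mulmx.
congr (_ + _); rewrite [LHS]mxE; congr (- _).
by rewrite [LHS]mxE mulmx_delta_mulmx.
Qed.

Lemma sum_sgn_mul_sympl M N : sympl N ->
  \sum_x \sum_y sgn x * sgn y * (M x (flip y) * N (flip x) y) = \tr (M *m N).
Proof.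
move=> sN; apply: eq_bigr => x _; rewrite mxE (reindex_inj (inv_inj flipK)).
apply: eq_bigr => y _ /=; rewrite (sN (flip x)) !flipK !sgn_flip.
rewrite -[RHS]mul1r -(sgn_sqr x) -[RHS]mul1r -(sgn_sqr y); ring.
Qed.

Lemma sum_sgn_mul1r M :
  \sum_x \sum_y sgn x * sgn y * (M x (flip y) * (1%:M : 'M[C]_(n + n)) (flip x) y) = - \tr M.
Proof.
rewrite -sumrN; apply: eq_bigr => x _; rewrite (bigD1 (flip x)) //= big1 ?addr0.
  by rewrite mxE eqxx flipK sgn_flip mulrN sgn_sqr mulr1 mulN1r.
by move=> y ne; rewrite mxE eq_sym (negbTE ne) !mulr0.
Qed.

Lemma sum_sgn_mul1l M :
  \sum_x \sum_y sgn x * sgn y * ((1%:M : 'M[C]_(n + n)) x (flip y) * M (flip x) y) = - \tr M.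
Proof.
rewrite -sumrN (reindex_inj (inv_inj flipK)); apply: eq_bigr => x _.
rewrite flipK (bigD1 x) //= big1 ?addr0.
  by rewrite mxE eqxx sgn_flip mulNr sgn_sqr mul1r mulN1r.
by move=> y ne; rewrite mxE (inj_eq (inv_inj flipK)) eq_sym (negbTE ne) mul0r mulr0.
Qed.

Lemma sympl_tr X : sympl X -> \tr X = 0.
Proof.
move=> sX; rewrite /mxtrace big_split_ord /= -big_split big1 //= => j _.
by rewrite (symplRR _ _ sX) subrr.
Qed.

Lemma ad_ad X Y M :
  ad X (ad Y M) = X *m Y *m M - X *m M *m Y - Y *m M *m X + M *m Y *m X.
Proof.
by rewrite /ad mulmxBr mulmxBl !mulmxA opprB addrA [in RHS]addrAC.
Qed.

(** In ad X ad Y the maps Z -> X Y Z and Z -> Z Y X contribute (2n + 1) tr(XY) each and the two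
    mixed maps tr(XY) each; half of the total is (2n + 2) tr(XY). *)
Lemma killingE X Y : sympl X -> sympl Y -> killing X Y = (n.*2.+2)%:R * \tr (X *m Y).
Proof.
move=> sX sY.
rewrite /killing (sum_coordE_sdelta (T := ad X \o ad Y)); last first.
  by move=> M sM; apply: sympl_ad => //; apply: sympl_ad.
have -> : \sum_x \sum_y (ad X \o ad Y) (sdelta x y) x y =
    \sum_x \sum_y ((X *m Y) *m sdelta x y *m 1%:M) x y
  - \sum_x \sum_y (X *m sdelta x y *m Y) x y
  - \sum_x \sum_y (Y *m sdelta x y *m X) x y
  + \sum_x \sum_y (1%:M *m sdelta x y *m (Y *m X)) x y.
  rewrite -!sumrB -big_split; apply: eq_bigr => x _.
  rewrite -!sumrB -big_split; apply: eq_bigr => y _ /=.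
  have entry (K L M N : 'M[C]_(n + n)) :
    (K - L - M + N) x y = K x y - L x y - M x y + N x y by rewrite !mxE.
  by rewrite -entry ad_ad mulmx1 mul1mx mulmxA.
rewrite !sum_mulmx_sdelta !(sum_sgn_mul_sympl _ sX) !(sum_sgn_mul_sympl _ sY).
rewrite sum_sgn_mul1r sum_sgn_mul1l (sympl_tr sX) (sympl_tr sY) mxtrace1.
rewrite (mxtrace_mulC Y X) -addnn -addn2 !natrD; by field.
Qed.

(** The trace of a basis vector times its opposite. The value 4 belongs to long roots, whose basis
    vectors have a single entry 2. *)
Definition nrm b : C :=
  match b with
  | inl _ => 2
  | inr (inl s) => if (sval s).1 == (sval s).2 then 4 else 2
  | inr (inr s) => if (sval s).1 == (sval s).2 then 4 else 2
  end.

Lemma nrm_neq0 b : nrm b != 0.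
Proof. by case: b => [?|[s|s]] /=; rewrite ?pnatr_eq0 //; case: ifP; rewrite pnatr_eq0. Qed.

Lemma tr_delta_mul x y M : \tr (delta_mx x y *m M) = M y x.
Proof.
rewrite -[delta_mx x y]mul1mx /mxtrace (bigD1 x) //= mulmx_delta_mulmx mxE eqxx mul1r.
by rewrite big1 ?addr0 // => u ne; rewrite mulmx_delta_mulmx mxE (negbTE ne) mul0r.
Qed.

Lemma tr_basisE_mul b M : sympl M -> \tr (basisE C b *m M) = nrm b * coordE M (opp b).
Proof.
move=> sM; case: b => [[j k]|[s|s]]; rewrite /basisE ?mulmxBl ?mulmxDl;
  rewrite ?mxtraceD ?raddfN /= !tr_delta_mul.
- by rewrite (symplRR _ _ sM); ring.
- rewrite (symplRL _ _ sM); case: eqP => [<-|_]; last by ring.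
  by field.
- rewrite (symplLR _ _ sM); case: eqP => [<-|_]; last by ring.
  by field.
Qed.

Lemma killing_basisE b M : sympl M ->
  killing (basisE C b) M = (n.*2.+2)%:R * nrm b * coordE M (opp b).
Proof. by move=> sM; rewrite killingE ?tr_basisE_mul ?mulrA //; apply: sympl_basisE. Qed.

Lemma oppK : involutive (@opp n).
Proof. by case=> [[j k]|[s|s]]. Qed.

Lemma nrm_opp b : nrm (opp b) = nrm b.
Proof. by case: b => [[j k]|[s|s]]. Qed.

Lemma killing_basisE2 b p :
  killing (basisE C b) (basisE C p) = (n.*2.+2)%:R * nrm b * (p == opp b)%:R.
Proof. by rewrite killing_basisE ?coordE_basisE //; apply: sympl_basisE. Qed.

Lemma dualvecE b : dualvec C b = ((n.*2.+2)%:R * nrm b)^-1 *: basisE C (opp b).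
Proof. by rewrite /dualvec killing_basisE2 oppK eqxx mulr1 nrm_opp. Qed.

End Symplectic.

(** * The grading, and the tensors in which W^* lies *)

Section Grading.
Variables (C : numClosedFieldType) (n i : nat).
Implicit Types (X Y M N : 'M[C]_(n + n)) (x y : 'I_(n + n)) (b p q : bidx n).

(** Eigenvalues of the grading element diag(1_i, 0, -1_i, 0) on coordinate vectors; the entry at (x,
    y) then has degree [ht x - ht y]. *)
Definition ht x : int :=
  match split x with inl j => (j < i)%N%:R | inr j => - (j < i)%N%:R end.

Lemma htL (j : 'I_n) : ht (lshift n j) = (j < i)%N%:R.
Proof. by rewrite /ht (unsplitK (inl j)). Qed.

Lemma htR (j : 'I_n) : ht (rshift n j) = - (j < i)%N%:R.
Proof. by rewrite /ht (unsplitK (inr j)). Qed.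

Lemma sum_eq_lt (j : 'I_n) : \sum_(l < n | (l < i)%N) (l == j)%:R = (j < i)%N%:R :> int.
Proof.
case ji: (j < i)%N; last first.
  by rewrite big1 // => l li; case: eqP => // e; rewrite e ji in li.
rewrite (bigD1 j) //= eqxx big1 ?addr0 // => l /andP[_ ne].
by rewrite (negbTE ne).
Qed.

Lemma degE b : deg i b = match b with
  | inl (j, k) => (j < i)%N%:R - (k < i)%N%:R
  | inr (inl s) => ((sval s).1 < i)%N%:R + ((sval s).2 < i)%N%:R
  | inr (inr s) => - (((sval s).1 < i)%N%:R + ((sval s).2 < i)%N%:R)
  end.
Proof.
by case: b => [[j k]|[s|s]]; rewrite /deg /= ?sumrN ?big_split /= ?sumrN !sum_eq_lt.
Qed.

Lemma deg_opp b : deg i (opp b) = - deg i b.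
Proof. by rewrite !degE; case: b => [[j k]|[s|s]] /=; rewrite ?opprB ?opprK. Qed.

Definition graded (d : int) M : Prop := forall x y, M x y != 0 -> ht x - ht y = d.

Lemma graded_eq0 d M x y : graded d M -> ht x - ht y != d -> M x y = 0.
Proof. by move=> hM; apply: contraNeq => /hM ->. Qed.

Lemma graded_add d M N : graded d M -> graded d N -> graded d (M + N).
Proof.
move=> hM hN x y; rewrite mxE; have [e|/hM //] := eqVneq (M x y) 0.
by rewrite e add0r => /hN.
Qed.

Lemma graded_scale (a : C) d M : graded d M -> graded d (a *: M).
Proof. by move=> hM x y; rewrite mxE mulf_eq0 negb_or => /andP[_ /hM]. Qed.

Lemma graded0 d : graded d 0.
Proof. by move=> x y; rewrite mxE eqxx. Qed.

Lemma graded_sum (I : Type) (r : seq I) (P : pred I) (F : I -> 'M[C]_(n + n)) d :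
  (forall j, P j -> graded d (F j)) -> graded d (\sum_(j <- r | P j) F j).
Proof. move=> hF; apply: big_ind hF => [|M N]; [exact: graded0|exact: graded_add]. Qed.

Lemma graded_mul c d M N : graded c M -> graded d N -> graded (c + d) (M *m N).
Proof.
move=> hM hN x y; rewrite mxE => ne.
have /existsP[z] : [exists z, M x z * N z y != 0].
  apply: contraNT ne; rewrite negb_exists => /forallP H.
  by rewrite big1 // => z _; apply/eqP; have:= H z; rewrite negbK.
by rewrite mulf_eq0 negb_or => /andP[/hM <- /hN <-]; rewrite addrA subrK.
Qed.

Lemma graded_ad c d M N : graded c M -> graded d N -> graded (c + d) (ad M N).
Proof.
move=> hM hN; apply: graded_add; first exact: graded_mul.
by rewrite -scaleN1r addrC; apply/graded_scale/graded_mul.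
Qed.

Lemma graded_delta x y : graded (ht x - ht y) (delta_mx x y).
Proof.
by move=> u v; rewrite mxE; case: andP => [[/eqP -> /eqP ->]|_] //; rewrite eqxx.
Qed.

Lemma graded_basisE b : graded (deg i b) (basisE C b).
Proof.
have hd d x y (a : C) : ht x - ht y = d -> graded d (a *: delta_mx x y).
  by move=> <-; apply/graded_scale/graded_delta.
have hd1 d x y : ht x - ht y = d -> graded d (delta_mx x y).
  by move=> /(hd _ _ _ 1); rewrite scale1r.
rewrite degE; case: b => [[j k]|[s|s]] /=; rewrite -?scaleN1r;
  apply: graded_add; (apply: hd || apply: hd1); rewrite ?htL ?htR ?opprK ?opprD //.
all: by rewrite addrC.
Qed.

Arguments graded_basisE b : clear implicits.

Lemma coordE_graded d M b : graded d M -> coordE M b != 0 -> deg i b = d.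
Proof.
move=> hM; rewrite degE; case: b => [[j k]|[s|s]]; rewrite ?coordE_B ?coordE_C /= ?mulf_eq0 ?negb_or;
  try case/andP=> _; by move/hM <-; rewrite !(htL, htR) ?opprK ?opprD.
Qed.

(** The l-submodule gl(i) (x) g(-2) containing W^*, described by supports; this support determines
    the shape of omega_2. *)
Definition gl_supp (Y : tens C n) : Prop := forall p q, Y p q != 0 ->
  deg i q = - 2 /\ exists j k : 'I_n, [/\ p = inl (j, k), (j < i)%N & (k < i)%N].

Lemma sum_neq0 (I : finType) (F : I -> C) : \sum_j F j != 0 -> exists j, F j != 0.
Proof.
move=> ne; apply/existsP; apply: contraNT ne; rewrite negb_exists => /forallP H.
by rewrite big1 // => z _; apply/eqP; have:= H z; rewrite negbK.
Qed.

Lemma gl_supp_actT b (Y : tens C n) : deg i b = 0 -> gl_supp Y -> gl_supp (actT (basisE C b) Y).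
Proof.
move=> db sY p q; rewrite /actT => ne.
have: (\sum_r coordE (ad (basisE C b) (basisE C r)) p * Y r q != 0)
   \/ (\sum_r coordE (ad (basisE C b) (basisE C r)) q * Y p r != 0).
  have [e|?] := eqVneq (\sum_r coordE (ad (basisE C b) (basisE C r)) p * Y r q) 0; last by left.
  by right; move: ne; rewrite e add0r.
case=> /sum_neq0[r]; rewrite mulf_eq0 negb_or => /andP[c0 /sY[dr]]; last first.
  move=> ex; split=> //; have := coordE_graded (graded_ad (graded_basisE b) (graded_basisE r)) c0.
  by rewrite db dr add0r.
case=> [j [k [er ji ki]]]; split=> //.
(* gl(i) is an ideal of l: its elements are the degree 0 matrices supported on nonzero heights, a
   shape that survives multiplication by degree 0 matrices on either side. *)
have blk x y : ad (basisE C b) (basisE C r) x y != 0 -> ht x = ht y /\ ht x != 0.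
  have hr u v : basisE C r u v != 0 -> ht u = ht v /\ ht u != 0.
    move=> ne0; move/graded_basisE: (ne0); rewrite er degE ji ki subrr => /eqP.
    rewrite subr_eq0 => /eqP e; split=> //; move: ne0; rewrite er /= !mxE.
    case: (u =P lshift n j) => [->|_]; first by rewrite htL ji.
    case: (u =P rshift n k) => [->|_]; first by rewrite htR ki.
    by rewrite subrr eqxx.
  have hb u v : basisE C b u v != 0 -> ht u = ht v.
    by move=> /graded_basisE; rewrite db => /eqP; rewrite subr_eq0 => /eqP.
  rewrite /ad mxE => ne0.
  have [e|] := eqVneq ((basisE C b *m basisE C r) x y) 0.
    move: ne0; rewrite e add0r mxE oppr_eq0 mxE => /sum_neq0[z].
    by rewrite mulf_eq0 negb_or => /andP[/hr[-> zz] /hb zy]; rewrite -zy.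
  rewrite mxE => /sum_neq0[z].
  by rewrite mulf_eq0 negb_or => /andP[/hb -> /hr].
move: c0; case: p ne => [[u v]|[s|s]] _; rewrite ?coordE_B ?coordE_C /= ?mulf_eq0 ?negb_or;
  try case/andP=> _; move/blk; rewrite ?htL ?htR.
- by case=> e ne; exists u, v; split=> //; move: e ne; case: (u < i)%N; case: (v < i)%N.
- by case: (_ < _)%N; case: (_ < _)%N => -[].
- by case: (_ < _)%N; case: (_ < _)%N => -[].
Qed.

Lemma inWdual_supp (Y : tens C n) : inWdual i Y -> gl_supp Y.
Proof.
elim=> {Y} [t [st _ _ _] //|t1 t2 _ s1 _ s2|a t _ st|b t db _ st|t1 t2 _ s1 e] p q.
- by have [e|/s1 //] := eqVneq (t1 p q) 0; rewrite e add0r => /s2.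
- by rewrite mulf_eq0 negb_or => /andP[_ /st].
- exact: gl_supp_actT.
- by rewrite -e => /s1.
Qed.

(** * An explicit formula for omega_2 *)

Local Notation K := ((n.*2.+2)%:R : C).

Lemma pairTE (Y u : tens C n) :
  pairT Y u = \sum_p \sum_q K * K * nrm C p * nrm C q * Y p q * u (opp p) (opp q).
Proof.
apply: eq_bigr => p _; apply: eq_bigr => q _.
rewrite (bigD1 (opp p)) //= [X in _ + X]big1 ?addr0 => [|p' ne]; last first.
  by rewrite big1 // => q' _; rewrite !killing_basisE2 (negbTE ne) !(mulr0, mul0r).
rewrite (bigD1 (opp q)) //= [X in _ + X]big1 ?addr0 => [|q' ne]; last first.
  by rewrite !killing_basisE2 (negbTE ne) !(mulr0, mul0r).
by rewrite !killing_basisE2 !eqxx !mulr1; ring.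
Qed.

(** Contracts the row index of the gl(i) factor with the column index of the g(-2) factor; [Qf] on
    g(1) depends on Y only through this matrix. *)
Definition eta (Y : tens C n) (v c : 'I_n) : C :=
  \sum_u \sum_q Y (inl (u, v)) q * basisE C q (rshift n c) (lshift n u).

Lemma K_neq0 : K != 0. Proof. by rewrite pnatr_eq0. Qed.

Lemma tau2E X p q : tau2 i X p q =
  if deg i q == 2 then 2^-1 * coordE (ad X (ad X (dualvec C q))) p else 0.
Proof.
rewrite /tau2; case: ifP => dq.
  rewrite (bigD1 q) //= eqxx mulr1 big1 ?addr0 // => g /andP[_ ne].
  by rewrite eq_sym (negbTE ne) mulr0.
rewrite big1 ?mulr0 // => g dg; case: eqP => [e|_]; last by rewrite mulr0.
by rewrite e dg in dq.
Qed.

(** The column has height 1, and no row has height 2. *)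
Lemma graded1_col0 X x (u : 'I_n) : graded 1 X -> (u < i)%N -> X x (lshift n u) = 0.
Proof.
move=> hX ui; apply: (graded_eq0 hX); rewrite htL ui; case: (split_ordP x) => j ->.
  by rewrite htL; case: (_ < _)%N.
by rewrite htR; case: (_ < _)%N.
Qed.

(** Every product in ad(X)^2 N that ends in X has a zero column here, so only X X N survives. *)
Lemma ad_ad_entry X N (v u : 'I_n) : graded 1 X -> graded (- 2) N -> (u < i)%N ->
  ad X (ad X N) (lshift n v) (lshift n u) =
  \sum_(c < n | (c < i)%N) (X *m X) (lshift n v) (rshift n c) * N (rshift n c) (lshift n u).
Proof.
move=> hX hN ui; rewrite ad_ad.
have XN0 (A : 'M[C]_(n + n)) x : (A *m X) x (lshift n u) = 0.
  by rewrite mxE big1 // => z _; rewrite (graded1_col0 z hX ui) mulr0.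
rewrite [LHS]mxE XN0 [X in X + _]mxE [X in _ + X + _]mxE XN0 oppr0 !addr0.
rewrite [LHS]mxE [X in _ + X]mxE XN0 oppr0 addr0.
rewrite [LHS]mxE big_split_ord /= big1 ?add0r => [|c _]; last first.
  by rewrite (graded_eq0 (x := lshift n c) hN) ?mulr0 // !htL ui; case: (_ < _)%N.
rewrite (bigID (fun c : 'I_n => (c < i)%N)) /= [X in _ + X]big1 ?addr0 // => c ci.
by rewrite (graded_eq0 (x := rshift n c) hN) ?mulr0 // htL htR ui (negbTE ci).
Qed.

Lemma QfE (Y : tens C n) X : gl_supp Y -> graded 1 X ->
  Qf i Y X = K * \sum_(v < n | (v < i)%N) \sum_(c < n | (c < i)%N)
     eta Y v c * (X *m X) (lshift n v) (rshift n c).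
Proof.
move=> sY hX; rewrite /Qf pairTE sum_bidx.
have noY p q : (forall j k, p <> inl (j, k)) -> Y p q = 0.
  by move=> np; apply/eqP; apply: contraT => /sY[_ [j [k [/np]]]].
rewrite [X in _ + (X + _)]big1 => [|s _]; last first.
  by rewrite big1 // => q _; rewrite noY ?(mulr0, mul0r).
rewrite [X in _ + (_ + X)]big1 ?addr0 => [|s _]; last first.
  by rewrite big1 // => q _; rewrite noY ?(mulr0, mul0r).
rewrite exchange_big (bigID (fun v : 'I_n => (v < i)%N)) /= [X in _ + X]big1 ?addr0; last first.
  move=> v vi; rewrite big1 // => u _; rewrite big1 // => q _.
  rewrite (_ : Y _ _ = 0) ?(mulr0, mul0r) //; apply/eqP; apply: contraT => /sY[_ [j [k [[_ ek] _ ki]]]].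
  by rewrite ek ki in vi.
rewrite mulr_sumr; apply: eq_bigr => v vi; rewrite mulr_sumr.
transitivity (\sum_u \sum_q \sum_(c < n | (c < i)%N) K * (Y (inl (u, v)) q *
    basisE C q (rshift n c) (lshift n u) * (X *m X) (lshift n v) (rshift n c))).
  apply: eq_bigr => u _; apply: eq_bigr => q _.
  have [->|Y0] := eqVneq (Y (inl (u, v)) q) 0.
    by rewrite !(mulr0, mul0r) big1 // => c _; rewrite !(mulr0, mul0r).
  have [dq [j [k [[eu _] ji _]]]] := sY _ _ Y0; rewrite -eu in ji.
  (* The dual vector cancels one of the two factors K and the norm of q; the norm 2 of an A-block
     vector cancels the 1/2 in [tau2]. *)
  rewrite tau2E deg_opp dq opprK eqxx dualvecE nrm_opp oppK !adZr coordEZ.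
  rewrite [coordE _ _]/= ad_ad_entry //; last by have := graded_basisE q; rewrite dq.
  rewrite mulr_sumr mulr_sumr mulr_sumr; apply: eq_bigr => c _.
  by move: K_neq0; move: K => k0 k00; field; rewrite nrm_neq0 k00.
under eq_bigr => u _ do rewrite exchange_big.
rewrite exchange_big; apply: eq_bigr => c ci /=; rewrite /eta mulr_suml mulr_sumr; apply: eq_bigr => u _.
by rewrite mulr_suml mulr_sumr.
Qed.

Lemma BfE (Y : tens C n) X1 X2 : gl_supp Y -> graded 1 X1 -> graded 1 X2 ->
  Bf i Y X1 X2 = K / 2 * \sum_(v < n | (v < i)%N) \sum_(c < n | (c < i)%N)
     eta Y v c * (X1 *m X2 + X2 *m X1) (lshift n v) (rshift n c).
Proof.
move=> sY h1 h2; rewrite /Bf !QfE //; last exact: graded_add.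
rewrite -!mulrBr -!sumrB mulrA [_^-1 * K]mulrC; congr (_ * _); apply: eq_bigr => v _.
rewrite -!sumrB; apply: eq_bigr => c _; rewrite mulmxDl !mulmxDr.
have entry (M N P Q : 'M[C]_(n + n)) x y :
  (M + N + (P + Q)) x y = M x y + Q x y + (N + P) x y by rewrite !mxE; ring.
by rewrite entry; ring.
Qed.

Lemma mulmx_graded1_entry X1 X2 (v c : 'I_n) : graded 1 X1 -> sympl X2 -> (v < i)%N ->
  (X1 *m X2) (lshift n v) (rshift n c) = \sum_(k < n | (i <= k)%N)
    (X1 (lshift n v) (lshift n k) * X2 (lshift n c) (rshift n k)
     - X1 (lshift n v) (rshift n k) * X2 (lshift n c) (lshift n k)).
Proof.
move=> h1 s2 vi; rewrite mxE big_split_ord /= -big_split /=.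
rewrite (bigID (fun k : 'I_n => (i <= k)%N)) /= [X in _ + X]big1 ?addr0.
  by apply: eq_bigr => k _; rewrite (symplLR k c s2) (symplRR k c s2) mulrN.
move=> k; rewrite -ltnNge => ki.
by rewrite !(graded_eq0 (x := lshift n v) h1) ?mul0r ?addr0 // ?htL ?htR vi ki.
Qed.

Definition Fidx (v k : 'I_n) : bidx n := inl (k, v).

(* The junk value is never reached: [Gidx c k] is only used for [c < i <= k]. *)
Definition Gidx (c k : 'I_n) : bidx n :=
  if insub (c, k) is Some s then inr (inr s) else inl (c, k).

Lemma GidxE (c k : 'I_n) (ck : (c <= k)%N) : Gidx c k = inr (inr (exist _ (c, k) ck)).
Proof. by rewrite /Gidx (@insubT _ (fun u : 'I_n * 'I_n => (u.1 <= u.2)%N) (symidx n) (c, k) ck). Qed.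

Lemma basisE_opp_LL p (v k : 'I_n) :
  basisE C (opp p) (lshift n v) (lshift n k) = (p == Fidx v k)%:R.
Proof.
rewrite -[LHS]/(coordE (basisE C (opp p)) (inl (v, k))) coordE_basisE.
by rewrite -(inj_eq (inv_inj (@oppK n))) oppK.
Qed.

Lemma basisE_opp_LR p (c k : 'I_n) : (c < k)%N ->
  basisE C (opp p) (lshift n c) (rshift n k) = (p == Gidx c k)%:R.
Proof.
move=> ck; rewrite (GidxE (ltnW ck)); set s := exist _ _ _.
have: coordE (basisE C (opp p)) (inr (inl s)) = basisE C (opp p) (lshift n c) (rshift n k).
  by rewrite coordE_B /half_if /= -val_eqE /= ltn_eqF // mul1r.
by move=> <-; rewrite coordE_basisE -(inj_eq (inv_inj (@oppK n))) oppK.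
Qed.

Lemma basisE_Gidx (c k : 'I_n) : (c < k)%N ->
  basisE C (Gidx c k) = sdelta C (rshift n c) (lshift n k).
Proof. by move=> ck; rewrite (GidxE (ltnW ck)) basisE_sdelta. Qed.

Lemma deg_Fidx (v k : 'I_n) : (v < i)%N -> (i <= k)%N -> deg i (Fidx v k) = -1.
Proof. by move=> vi ik; rewrite degE /= vi ltnNge ik. Qed.

Lemma deg_Gidx (v k : 'I_n) : (v < i)%N -> (i <= k)%N -> deg i (Gidx v k) = -1.
Proof.
by move=> vi ik; rewrite (GidxE (ltnW (leq_trans vi ik))) degE /= vi ltnNge ik.
Qed.

(** Long roots have even degree. *)
Lemma nrm_deg1 b : deg i b = 1 -> nrm C b = 2.
Proof.
rewrite degE; case: b => [[j k]|[s|s]] //=; case: eqP => // ->; by case: (_ < _)%N.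
Qed.

(** The coefficient at the word p q of F_vk G_ck - G_vk F_ck plus the same expression with each
    product reversed, as symmetrisation demands. *)
Definition omega_term p q (v c k : 'I_n) : C :=
  (p == Fidx v k)%:R * (q == Gidx c k)%:R - (p == Gidx v k)%:R * (q == Fidx c k)%:R
  + (p == Gidx c k)%:R * (q == Fidx v k)%:R - (p == Fidx c k)%:R * (q == Gidx v k)%:R.

(** Each of the two dual vectors contributes 1/(2K) and polarisation contributes K/2, whence
    1/(8K). *)
Lemma omega2E (Y : tens C n) p q : gl_supp Y ->
  omega2 i Y [:: p; q] = (8 * K)^-1 * \sum_(v < n | (v < i)%N) \sum_(c < n | (c < i)%N)
     eta Y v c * \sum_(k < n | (i <= k)%N) omega_term p q v c k.
Proof.
move=> sY.
have term0 : (deg i p != -1) || (deg i q != -1) ->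
    forall v c k : 'I_n, (v < i)%N -> (c < i)%N -> (i <= k)%N -> omega_term p q v c k = 0.
  move=> H v c k vi ci ik; rewrite /omega_term.
  have [np|nq] := orP H; [have ne r : deg i r = -1 -> (p == r) = false
                         |have ne r : deg i r = -1 -> (q == r) = false].
  - by move=> dr; apply: contraNF np => /eqP ->; rewrite dr.
  - by rewrite !ne ?deg_Fidx ?deg_Gidx // !mul0r subr0 addr0 subr0.
  - by move=> dr; apply: contraNF nq => /eqP ->; rewrite dr.
  - by rewrite !ne ?deg_Fidx ?deg_Gidx // !mulr0 subr0 addr0 subr0.
have dual_coord (a r : bidx n) : deg i a == 1 -> coordE (dualvec C a) r = (2 * K)^-1 * (r == opp a)%:R.
  by move=> /eqP da; rewrite dualvecE coordEZ coordE_basisE (nrm_deg1 da) eq_sym [K * _]mulrC.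
have -> : omega2 i Y [:: p; q] = if (deg i p == -1) && (deg i q == -1) then
    (2 * K)^-1 ^+ 2 * (2^-1 * (Bf i Y (basisE C (opp p)) (basisE C (opp q))
                             + Bf i Y (basisE C (opp q)) (basisE C (opp p)))) else 0.
  pose t (a b r u : bidx n) := (r == opp a)%:R * (u == opp b)%:R : C.
  have eqo (r a : bidx n) : (r == opp a) = (a == opp r).
    by rewrite -(inj_eq (inv_inj (@oppK n))) oppK eq_sym.
  have degN (r : bidx n) : (deg i (opp r) == 1) = (deg i r == -1) by rewrite deg_opp eqr_oppLR.
  have sum2 (r u : bidx n) : \sum_(a : bidx n | deg i a == 1) \sum_(b : bidx n | deg i b == 1)
       Bf i Y (basisE C a) (basisE C b) * t a b r u
     = if (deg i r == -1) && (deg i u == -1) then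
       Bf i Y (basisE C (opp r)) (basisE C (opp u)) else 0.
    rewrite big_mkcond (bigD1 (opp r)) //= degN [X in _ + X]big1 ?addr0; last first.
      move=> a ne; case: ifP => // _; rewrite big1 // => b _.
      by rewrite /t eqo (negbTE ne) mul0r mulr0.
    case: (deg i r == -1) => //=.
    rewrite big_mkcond (bigD1 (opp u)) //= degN [X in _ + X]big1 ?addr0; last first.
      by move=> b ne; case: ifP => // _; rewrite /t [u == _]eqo (negbTE ne) !mulr0.
    by rewrite /t !oppK !eqxx !mulr1.
  transitivity ((2 * K)^-1 ^+ 2 * 2^-1 * (\sum_(a : bidx n | deg i a == 1)
       \sum_(b : bidx n | deg i b == 1) Bf i Y (basisE C a) (basisE C b) * t a b p q
     + \sum_(a : bidx n | deg i a == 1) \sum_(b : bidx n | deg i b == 1)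
         Bf i Y (basisE C a) (basisE C b) * t a b q p)).
    rewrite -big_split mulr_sumr; apply: eq_bigr => a da.
    rewrite -big_split mulr_sumr; apply: eq_bigr => b db /=.
    by rewrite !dual_coord // /t; ring.
  by rewrite !sum2 [X in _ + (if X then _ else _)]andbC; case: ifP => _; ring.
case: ifP => [/andP[/eqP dp /eqP dq]|/negbT H]; last first.
  rewrite negb_and in H; rewrite big1 ?mulr0 // => v vi; rewrite big1 // => c ci.
  by rewrite big1 ?mulr0 // => k ik; rewrite term0.
have h (r : bidx n) : deg i r = -1 -> graded 1 (basisE C (opp r)).
  by move=> dr; have := graded_basisE (opp r); rewrite deg_opp dr opprK.
have hp := h p dp; have hq := h q dq.
have -> : Bf i Y (basisE C (opp q)) (basisE C (opp p))
        = Bf i Y (basisE C (opp p)) (basisE C (opp q)).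
  rewrite !BfE //; congr (_ * _); apply: eq_bigr => v _; apply: eq_bigr => c _.
  by rewrite addrC.
have half S : (2 * K)^-1 ^+ 2 * (2^-1 * (K / 2 * S + K / 2 * S)) = (8 * K)^-1 * S.
  by move: K_neq0; move: K => k0 k00; field; rewrite k00.
rewrite BfE // half; congr (_ * _).
apply: eq_bigr => v vi; apply: eq_bigr => c ci; congr (_ * _).
rewrite mxE !mulmx_graded1_entry //; try exact: sympl_basisE.
rewrite -big_split; apply: eq_bigr => k ik /=.
rewrite !basisE_opp_LL !basisE_opp_LR ?(leq_trans _ ik) // /omega_term.
by ring.
Qed.

(** Substitutes omega_2 into an arbitrary function of its two letters; [word3_red] will be that
    function. *)
Lemma sum_omega2 (V : lmodType C) (Y : tens C n) (Phi : bidx n -> bidx n -> V) : gl_supp Y ->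
  \sum_p \sum_q omega2 i Y [:: p; q] *: Phi p q =
  (8 * K)^-1 *: \sum_(v < n | (v < i)%N) \sum_(c < n | (c < i)%N)
     eta Y v c *: \sum_(k < n | (i <= k)%N)
       (Phi (Fidx v k) (Gidx c k) - Phi (Gidx v k) (Fidx c k)
        + Phi (Gidx c k) (Fidx v k) - Phi (Fidx c k) (Gidx v k)).
Proof.
move=> sY.
under eq_bigr => p _ do under eq_bigr => q _ do rewrite omega2E // -scalerA scaler_suml.
rewrite pair_big /=.
rewrite -scaler_sumr; congr (_ *: _); rewrite exchange_big; apply: eq_bigr => v _.
under eq_bigr => u _ do rewrite scaler_suml.
rewrite exchange_big; apply: eq_bigr => c _ /=.
under eq_bigr => u _ do rewrite -scalerA.
rewrite -scaler_sumr; congr (_ *: _).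
under [LHS]eq_bigr => u _ do rewrite scaler_suml.
rewrite exchange_big; apply: eq_bigr => k _ /=.
have sum1 (r t : bidx n) : \sum_(u : bidx n * bidx n)
    ((u.1 == r)%:R * (u.2 == t)%:R : C) *: Phi u.1 u.2 = Phi r t.
  rewrite (bigD1 (r, t)) //= !eqxx mulr1 scale1r big1 ?addr0 // => -[u1 u2] /=.
  by rewrite xpair_eqE negb_and => /orP[] /negbTE ->; rewrite ?mul0r ?mulr0 scale0r.
under eq_bigr => u _ do rewrite /omega_term !scalerDl !scaleNr.
by rewrite !big_split /= !sumrN !sum1.
Qed.

End Grading.

Arguments graded_basisE C [n] i b.

(** * Reduction of X omega_2(Y) in the generalized Verma module *)

Section Verma.
Variables (C : numClosedFieldType) (n i : nat) (s : C).
Implicit Types (X M N W : 'M[C]_(n + n)) (x y : 'I_(n + n)) (b p q r : bidx n).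
Implicit Types (v c k : 'I_n).

Definition chiM M : C := - s * \sum_(j < n | (j < i)%N) M (lshift n j) (lshift n j).

Lemma chiMD M N : chiM (M + N) = chiM M + chiM N.
Proof.
rewrite /chiM -mulrDr -big_split /=; congr (_ * _).
by apply: eq_bigr => j _; rewrite mxE.
Qed.

Lemma chiMZ (a : C) M : chiM (a *: M) = a * chiM M.
Proof.
rewrite /chiM mulrCA [a * _]mulr_sumr; congr (_ * _).
by apply: eq_bigr => j _; rewrite mxE.
Qed.

Lemma chiM0 : chiM 0 = 0.
Proof. by rewrite -(scale0r 0) chiMZ mul0r. Qed.

Lemma chiM_sum (I : Type) (t : seq I) (P : pred I) (F : I -> 'M[C]_(n + n)) :
  chiM (\sum_(j <- t | P j) F j) = \sum_(j <- t | P j) chiM (F j).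
Proof. exact: (big_morph chiM chiMD chiM0). Qed.

Lemma chiM_graded d M : graded i d M -> d != 0 -> chiM M = 0.
Proof.
move=> hM d0; rewrite /chiM big1 ?mulr0 // => j _.
by rewrite (graded_eq0 hM) // subrr eq_sym.
Qed.

Lemma sum_coordE_chi M : \sum_r coordE M r * chi i s r = chiM M.
Proof.
rewrite sum_bidx /= ![X in _ + (X + _)]big1 ?add0r => [|u _]; last by rewrite mulr0.
rewrite [X in _ + X]big1 ?addr0 => [|u _]; last by rewrite mulr0.
rewrite /chiM mulr_sumr [RHS]big_mkcond; apply: eq_bigr => j _ /=.
rewrite (bigD1 j) //= eqxx big1 ?addr0 => [|k ne]; last first.
  by rewrite eq_sym (negbTE ne) mulr0.
by case: (j < i)%N; rewrite ?mulr0 // mulrC.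
Qed.

Lemma inJ_sum (I : Type) (t : seq I) (P : pred I) (F : I -> talg C n) :
  (forall j, P j -> inJ i s (F j)) -> inJ i s (fun w => \sum_(j <- t | P j) F j w).
Proof.
move=> JF; elim: t => [|j t IH].
  by apply: Jext (J0 n i s) _ => w; rewrite big_nil.
case Pj: (P j).
  by apply: Jext (JD (JF j Pj) IH) _ => w; rewrite big_cons Pj.
by apply: Jext IH _ => w; rewrite big_cons Pj.
Qed.

Lemma inJ_parabolic d M (a : seq (bidx n)) : graded i d M -> 0 <= d ->
  inJ i s (fun w => \sum_r coordE M r * (w == rcons a r)%:R - chiM M * (w == a)%:R).
Proof.
move=> hM d0.
have J1 r : true -> inJ i s (fun w =>
    coordE M r * ((w == rcons a r)%:R - chi i s r * (w == a)%:R)).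
  move=> _; have [e|ne] := eqVneq (coordE M r) 0.
    by apply: Jext (J0 n i s) _ => w; rewrite e mul0r.
  by apply/JZ/Jq; rewrite (coordE_graded hM ne).
apply: Jext (inJ_sum (index_enum (bidx n)) J1) _ => w.
rewrite -sum_coordE_chi mulr_suml -sumrB; apply: eq_bigr => r _.
by rewrite mulrBr mulrA.
Qed.

(** For X in n and M, N in g(-1) this matrix and the product X M N have the same effect on the
    generator: X annihilates it, and [X, M] and [X, N] lie in q, hence become scalars once they
    stand next to it. *)
Definition word3_red X M N := ad (ad X M) N + chiM (ad X M) *: N + chiM (ad X N) *: M.

Lemma inJ_word3 b p q : 1 <= deg i b -> deg i p = -1 -> deg i q = -1 ->
  inJ i s (fun w => (w == [:: b; p; q])%:R
     - \sum_r coordE (word3_red (basisE C b) (basisE C p) (basisE C q)) r * (w == [:: r])%:R).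
Proof.
move=> db dp dq.
have dbp : 0 <= deg i b + deg i p by rewrite dp subr_ge0.
have dbq : 0 <= deg i b + deg i q by rewrite dq subr_ge0.
(* The relations realise b p q = [b, p] q + p [b, q] + p q b and [b, p] q = [[b, p], q] + q [b, p],
   and then evaluate each final letter from q on the generator. *)
have J1 := Jlie i s [::] [:: q] b p.
have J2 := Jlie i s [:: p] [::] b q.
have J3 := Jq s [:: p; q] (le_trans ler01 db).
have J4 := inJ_parabolic [:: p] (graded_ad (graded_basisE C i b) (graded_basisE C i q)) dbq.
(* [Jlie] concerns basis vectors, so [b, p] is moved past q one basis component at a time. *)
have J5 r : true -> inJ i s (fun w => coordE (ad (basisE C b) (basisE C p)) r *
   ((w == [::] ++ r :: q :: [::])%:R - (w == [::] ++ q :: r :: [::])%:R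
    - \sum_(t : bidx n) coordE (ad (basisE C r) (basisE C q)) t * (w == [::] ++ t :: [::])%:R)).
  by move=> _; apply/JZ/Jlie.
have J6 := inJ_parabolic [:: q] (graded_ad (graded_basisE C i b) (graded_basisE C i p)) dbp.
have chib : chi i s b = 0.
  move: db; rewrite degE; case: (b) => [[j k]|//] /=.
  by case: eqP => [->|//]; rewrite subrr.
apply: Jext (JD (JD (JD J1 J2) (JD J3 J4)) (JD (inJ_sum (index_enum (bidx n)) J5) J6)) _ => w /=.
rewrite chib mul0r subr0.
under [X in _ + (X + _)]eq_bigr => r _ do rewrite !mulrBr.
rewrite !sumrB.
have -> : \sum_r coordE (word3_red (basisE C b) (basisE C p) (basisE C q)) r * (w == [:: r])%:R
  = \sum_r coordE (ad (basisE C b) (basisE C p)) r *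
      (\sum_(t : bidx n) coordE (ad (basisE C r) (basisE C q)) t * (w == [:: t])%:R)
    + chiM (ad (basisE C b) (basisE C p)) * (w == [:: q])%:R
    + chiM (ad (basisE C b) (basisE C q)) * (w == [:: p])%:R.
  under eq_bigr => r _ do rewrite 2!coordED !coordEZ !coordE_basisE !mulrDl.
  rewrite !big_split /=; congr (_ + _ + _).
  - under [RHS]eq_bigr => r _ do rewrite mulr_sumr.
    rewrite [RHS]exchange_big; apply: eq_bigr => t _ /=.
    rewrite {1}(sympl_expand (sympl_ad (sympl_basisE C b) (sympl_basisE C p))).
    rewrite ad_suml coordE_sum mulr_suml; apply: eq_bigr => r _.
    by rewrite adZl coordEZ mulrA.
  - rewrite (bigD1 q) //= eqxx mulr1 big1 ?addr0 // => r ne.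
    by rewrite eq_sym (negbTE ne) mulr0 mul0r.
  - rewrite (bigD1 p) //= eqxx mulr1 big1 ?addr0 // => r ne.
    by rewrite eq_sym (negbTE ne) mulr0 mul0r.
by ring.
Qed.

Lemma lmulT_quadratic b (f : talg C n) w : (forall u, size u != 2%N -> f u = 0) ->
  lmulT b f w = \sum_p \sum_q f [:: p; q] * (w == [:: b; p; q])%:R.
Proof.
move=> f0.
have zero : (forall p q, w <> [:: b; p; q]) ->
    \sum_p \sum_q f [:: p; q] * (w == [:: b; p; q])%:R = 0.
  move=> H; rewrite big1 // => p _; rewrite big1 // => q _.
  by case: eqP => [/H|_] //; rewrite mulr0.
case: w zero => [|c0 [|p0 [|q0 [|r0 w]]]] zero; rewrite [LHS]/=;
  try by rewrite zero ?f0 ?mulr0 //; move=> ? ? [].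
rewrite (bigD1 p0) //= (bigD1 q0) //= big1 ?addr0 => [|q ne]; last first.
  rewrite (_ : _ == _ = false) ?mulr0 //; apply/eqP => -[_ e].
  by rewrite e eqxx in ne.
rewrite big1 ?addr0 => [|p ne]; last first.
  rewrite big1 // => q _; rewrite (_ : _ == _ = false) ?mulr0 //; apply/eqP => -[_ e].
  by rewrite e eqxx in ne.
by rewrite mulrC eqseq_cons eqxx andbT.
Qed.

Lemma lmulT_omega2E b (Y : tens C n) w : lmulT b (omega2 i Y) w =
  \sum_p \sum_q omega2 i Y [:: p; q] * (w == [:: b; p; q])%:R.
Proof. by apply: lmulT_quadratic => -[|? [|? [|? ?]]]. Qed.

Definition omega_red b (Y : tens C n) := \sum_p \sum_q
  omega2 i Y [:: p; q] *: word3_red (basisE C b) (basisE C p) (basisE C q).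

Lemma omega2_supp (Y : tens C n) p q : omega2 i Y [:: p; q] != 0 ->
  deg i p = -1 /\ deg i q = -1.
Proof.
have dual0 a r : deg i a == 1 -> deg i r != -1 -> coordE (dualvec C a) r = 0.
  move=> /eqP da dr; rewrite dualvecE coordEZ coordE_basisE; case: eqP => [e|_]; rewrite ?mulr0 //.
  by rewrite -e deg_opp da eqxx in dr.
move=> ne; split; apply/eqP; apply: contraNT ne => nr; rewrite /omega2;
  apply/eqP; rewrite big1 // => a da; rewrite big1 // => b db;
  by rewrite (dual0 _ _ da nr) (dual0 _ _ db nr) ?(mulr0, mul0r) addr0 !mulr0.
Qed.

Lemma inJ_lmulT_omega2 b (Y : tens C n) : 1 <= deg i b ->
  inJ i s (fun w => lmulT b (omega2 i Y) w
                    - \sum_r coordE (omega_red b Y) r * (w == [:: r])%:R).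
Proof.
move=> db.
have J1 p : true -> inJ i s (fun w => \sum_q omega2 i Y [:: p; q] *
    ((w == [:: b; p; q])%:R - \sum_r coordE
       (word3_red (basisE C b) (basisE C p) (basisE C q)) r * (w == [:: r])%:R)).
  move=> _; apply: inJ_sum => q _.
  have [e|/omega2_supp[dp dq]] := eqVneq (omega2 i Y [:: p; q]) 0.
    by apply: Jext (J0 n i s) _ => w; rewrite e mul0r.
  by apply/JZ/inJ_word3.
apply: Jext (inJ_sum (index_enum (bidx n)) J1) _ => w.
rewrite lmulT_omega2E /omega_red.
under [X in _ = _ - X]eq_bigr => r _.
  rewrite coordE_sum mulr_suml.
  under eq_bigr => p _ do rewrite coordE_sum mulr_suml.
  over.
rewrite [X in _ = _ - X]exchange_big -sumrB; apply: eq_bigr => p _ /=.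
rewrite [X in _ = _ - X]exchange_big -sumrB; apply: eq_bigr => q _ /=.
rewrite mulrBr mulr_sumr; congr (_ - _); apply: eq_bigr => r _.
by rewrite coordEZ mulrA.
Qed.

(** * Commuting an element of g(1) or g(2) through omega_2 *)

Lemma mulmx_delta_entry M x y (u z : 'I_(n + n)) :
  (M *m delta_mx x y) u z = M u x * (z == y)%:R.
Proof. by rewrite -[_ *m _]mulmx1 mulmx_delta_mulmx mxE [y == z]eq_sym. Qed.

Lemma delta_mulmx_entry M x y (u z : 'I_(n + n)) :
  (delta_mx x y *m M) u z = (u == x)%:R * M y z.
Proof. by rewrite -[delta_mx x y]mul1mx mulmx_delta_mulmx mxE. Qed.

Lemma delta_mul_delta M x y (u z : 'I_(n + n)) :
  delta_mx x y *m M *m delta_mx u z = M y u *: delta_mx x z.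
Proof.
apply/matrixP => a b; rewrite mulmx_delta_entry delta_mulmx_entry [RHS]mxE.
by rewrite [X in _ = _ * X]mxE -mulnb natrM; ring.
Qed.

Lemma basisE_FidxE v k : basisE C (Fidx v k) =
  delta_mx (lshift n k) (lshift n v) - delta_mx (rshift n v) (rshift n k).
Proof. by []. Qed.

Lemma basisE_GidxE c k : (c < k)%N -> basisE C (Gidx c k) =
  delta_mx (rshift n c) (lshift n k) + delta_mx (rshift n k) (lshift n c).
Proof. by move=> ck; rewrite basisE_Gidx // sdeltaRL. Qed.

Lemma lt_neq v k : (v < i)%N -> (i <= k)%N -> (v == k) = false.
Proof. by move=> vi ik; rewrite -val_eqE /= ltn_eqF // (leq_trans vi). Qed.

Lemma chiM_ad_F W v k : (v < i)%N -> (i <= k)%N ->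
  chiM (ad W (basisE C (Fidx v k))) = - s * W (lshift n v) (lshift n k).
Proof.
move=> vi ik; rewrite /chiM; congr (_ * _).
have e (j : 'I_n) : (j < i)%N -> ad W (basisE C (Fidx v k)) (lshift n j) (lshift n j)
    = W (lshift n j) (lshift n k) * (j == v)%:R.
  move=> ji; rewrite basisE_FidxE /ad mulmxBr mulmxBl.
  have entry (K L M N : 'M[C]_(n + n)) x y :
    (K - L - (M - N)) x y = K x y - L x y - (M x y - N x y) by rewrite !mxE.
  rewrite entry !mulmx_delta_entry !delta_mulmx_entry.
  by rewrite !eq_lshift !eq_lrshift (lt_neq ji ik) !mulr0n; ring.
rewrite (eq_bigr _ e) (bigD1 v) //= eqxx mulr1 big1 ?addr0 // => j /andP[_ ne].
by rewrite (negbTE ne) mulr0.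
Qed.

Lemma chiM_ad_G W c k : (c < i)%N -> (i <= k)%N ->
  chiM (ad W (basisE C (Gidx c k))) = - s * W (lshift n c) (rshift n k).
Proof.
move=> ci ik; rewrite /chiM; congr (_ * _).
have e (j : 'I_n) : (j < i)%N -> ad W (basisE C (Gidx c k)) (lshift n j) (lshift n j)
    = W (lshift n j) (rshift n k) * (j == c)%:R.
  move=> ji; rewrite basisE_GidxE ?(leq_trans ci) // /ad mulmxDr mulmxDl.
  have entry (K L M N : 'M[C]_(n + n)) x y :
    (K + L - (M + N)) x y = K x y + L x y - (M x y + N x y) by rewrite !mxE.
  rewrite entry !mulmx_delta_entry !delta_mulmx_entry.
  by rewrite !eq_lshift !eq_lrshift (lt_neq ji ik) !mulr0n; ring.
rewrite (eq_bigr _ e) (bigD1 c) //= eqxx mulr1 big1 ?addr0 // => j /andP[_ ne].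
by rewrite (negbTE ne) mulr0.
Qed.

(** The part G F X + X F G of [[X, F], G] for F = F_vk and G = G_ck. The products F G and G F do not
    involve k, so summing over k multiplies this part by n - i. *)
Definition Rmx X v c := delta_mx (rshift n c) (lshift n v) *m X
                      - X *m delta_mx (rshift n v) (lshift n c).

Lemma mulmx_FG v c k : (v < i)%N -> (c < i)%N -> (i <= k)%N ->
  basisE C (Fidx v k) *m basisE C (Gidx c k) = - delta_mx (rshift n v) (lshift n c).
Proof.
move=> vi ci ik; rewrite basisE_FidxE basisE_GidxE ?(leq_trans ci) //.
rewrite mulmxBl !mulmxDr !mul_delta_mx_cond.
rewrite !eq_lrshift !eq_rshift [k == c]eq_sym (lt_neq ci ik) eqxx.
by rewrite !mulr0n mulr1n !add0r.
Qed.

Lemma mulmx_GF v c k : (v < i)%N -> (c < i)%N -> (i <= k)%N ->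
  basisE C (Gidx c k) *m basisE C (Fidx v k) = delta_mx (rshift n c) (lshift n v).
Proof.
move=> vi ci ik; rewrite basisE_FidxE basisE_GidxE ?(leq_trans ci) //.
rewrite mulmxBr !mulmxDl !mul_delta_mx_cond.
rewrite !eq_lrshift !eq_lshift (lt_neq ci ik) eqxx.
by rewrite !mulr0n mulr1n !addr0 subr0.
Qed.

Lemma adad_expand X M N : ad (ad X M) N =
  (N *m M) *m X + X *m (M *m N) - (M *m X *m N + N *m X *m M).
Proof.
rewrite /ad mulmxBl mulmxBr !mulmxA opprB opprD.
rewrite [_ *m X + _]addrC -!addrA; congr (_ + _).
by rewrite addrC -addrA; congr (_ + _); rewrite addrC.
Qed.

(** The cross products F X G and G X F pick single entries of X; those of degree other than 1
    vanish, and the rest assemble into F_ck and G_vk. *)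
Lemma adad_FG X v c k : sympl X -> graded i 1 X -> (v < i)%N -> (c < i)%N -> (i <= k)%N ->
  ad (ad X (basisE C (Fidx v k))) (basisE C (Gidx c k)) = Rmx X v c
    - X (lshift n v) (rshift n k) *: basisE C (Fidx c k)
    - X (lshift n c) (lshift n k) *: basisE C (Gidx v k).
Proof.
move=> sX hX vi ci ik; have ki : (k < i)%N = false by rewrite ltnNge ik.
set F := basisE C (Fidx v k); set G := basisE C (Gidx c k).
rewrite adad_expand /F /G.
rewrite mulmx_FG // mulmx_GF // mulmxN -/(Rmx X v c) -[RHS]addrA -opprD; congr (_ - _).
rewrite /F /G !basisE_GidxE ?(leq_trans _ ik) // !basisE_FidxE.
rewrite !mulmxDr !mulmxDl ?mulNmx ?mulmxN !delta_mul_delta.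
have z x y : ht i x - ht i y != 1 -> X x y = 0 by exact: graded_eq0.
rewrite (z (lshift n v) (rshift n c)) ?htL ?htR ?vi ?ci //.
rewrite (z (rshift n k) (rshift n k)) ?subrr //.
rewrite (z (lshift n k) (lshift n k)) ?subrr //.
rewrite (z (lshift n c) (rshift n v)) ?htL ?htR ?vi ?ci //.
rewrite (symplRR k c sX) (symplLR k v sX) !scale0r !scaleNr !scalerDr !scalerN.
by apply/matrixP => x y; rewrite !mxE; ring.
Qed.

(** Row v of X lives in columns of height 0, so [Rmx] is itself a sum over k of the root vectors
    that the cross terms and the character terms produce. This makes all contributions
    comparable. *)
Lemma Rmx_expand X v c : sympl X -> graded i 1 X -> (v < i)%N -> (c < i)%N ->
  Rmx X v c = \sum_(k < n | (i <= k)%N)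
    (X (lshift n v) (lshift n k) *: basisE C (Gidx c k)
     - X (lshift n v) (rshift n k) *: basisE C (Fidx c k)).
Proof.
move=> sX hX vi ci; apply/matrixP => x y; rewrite summxE.
have -> : Rmx X v c x y = (x == rshift n c)%:R * X (lshift n v) y
                        - X x (rshift n v) * (y == lshift n c)%:R.
  have entry (M N : 'M[C]_(n + n)) : (M - N) x y = M x y - N x y by rewrite !mxE.
  by rewrite entry mulmx_delta_entry delta_mulmx_entry.
transitivity (\sum_(k < n | (i <= k)%N) ((x == rshift n c)%:R *
     (X (lshift n v) (lshift n k) * (y == lshift n k)%:R
      + X (lshift n v) (rshift n k) * (y == rshift n k)%:R)
   + (X (lshift n v) (lshift n k) * (x == rshift n k)%:R
      - X (lshift n v) (rshift n k) * (x == lshift n k)%:R) * (y == lshift n c)%:R)); last first.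
  apply: eq_bigr => k ik; rewrite basisE_GidxE ?(leq_trans ci) // basisE_FidxE !mxE -!mulnb !natrM.
  by ring.
rewrite big_split /= -mulr_sumr -mulr_suml; congr (_ * _ + _).
  rewrite big_split /=; case: (split_ordP y) => l ->.
    rewrite [X in _ + X]big1 ?addr0 => [|k _]; last by rewrite eq_lrshift mulr0.
    have [il|li] := leqP i l; last first.
      rewrite (graded_eq0 hX) ?htL ?vi ?li // big1 // => k ik.
      by rewrite eq_lshift (lt_neq li ik) mulr0.
    rewrite (bigD1 l) //= eqxx mulr1 big1 ?addr0 // => k /andP[_ ne].
    by rewrite eq_lshift eq_sym (negbTE ne) mulr0.
  rewrite big1 ?add0r => [|k _]; last by rewrite eq_rlshift mulr0.
  have [il|li] := leqP i l; last first.
    rewrite (graded_eq0 hX) ?htL ?htR ?vi ?li // big1 // => k ik.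
    by rewrite eq_rshift (lt_neq li ik) mulr0.
  rewrite (bigD1 l) //= eqxx mulr1 big1 ?addr0 // => k /andP[_ ne].
  by rewrite eq_rshift eq_sym (negbTE ne) mulr0.
rewrite -mulNr; congr (_ * _).
rewrite sumrB; case: (split_ordP x) => l ->.
  rewrite big1 ?sub0r => [|k _]; last by rewrite eq_lrshift mulr0.
  rewrite (symplLR l v sX); congr (- _).
  have [il|li] := leqP i l; last first.
    rewrite (graded_eq0 hX) ?htL ?htR ?vi ?li // big1 // => k ik.
    by rewrite eq_lshift (lt_neq li ik) mulr0.
  rewrite (bigD1 l) //= eqxx mulr1 big1 ?addr0 // => k /andP[_ ne].
  by rewrite eq_lshift eq_sym (negbTE ne) mulr0.
rewrite [X in _ - X]big1 ?subr0 => [|k _]; last by rewrite eq_rlshift mulr0.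
rewrite (symplRR l v sX) opprK.
have [il|li] := leqP i l; last first.
  rewrite (graded_eq0 hX) ?htL ?vi ?li // big1 // => k ik.
  by rewrite eq_rshift (lt_neq li ik) mulr0.
rewrite (bigD1 l) //= eqxx mulr1 big1 ?addr0 // => k /andP[_ ne].
by rewrite eq_rshift eq_sym (negbTE ne) mulr0.
Qed.

Lemma adad_GF X v c k : sympl X -> graded i 1 X -> (v < i)%N -> (c < i)%N -> (i <= k)%N ->
  ad (ad X (basisE C (Gidx c k))) (basisE C (Fidx v k)) = - Rmx X c v
    - X (lshift n v) (rshift n k) *: basisE C (Fidx c k)
    - X (lshift n c) (lshift n k) *: basisE C (Gidx v k).
Proof.
move=> sX hX vi ci ik.
(* The Jacobi identity, with the inner commutator left as two products because [mulmx_FG] and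
   [mulmx_GF] evaluate them. *)
have adC (M N : 'M[C]_(n + n)) :
    ad (ad X N) M = ad (ad X M) N + ad X (N *m M) - ad X (M *m N).
  by rewrite !adad_expand /ad !mulmxA; apply/matrixP => x y; rewrite !mxE; ring.
rewrite adC adad_FG // mulmx_FG // mulmx_GF // /Rmx /ad.
rewrite mulmxN mulNmx.
set D := X *m delta_mx (rshift n v) _; set D' := _ *m X; set E := _ *m X; set E' := X *m _.
by apply/matrixP => x y; rewrite !mxE; ring.
Qed.

(** Each k gives twice the full difference of the two [Rmx] and 2 (1 - s) times the k-th term of its
    expansion by [Rmx_expand]. The sum over k is 2 (n - i) + 2 (1 - s) copies. *)
Lemma sum_word3_red X v c : (i <= n)%N -> sympl X -> graded i 1 X -> (v < i)%N -> (c < i)%N ->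
  \sum_(k < n | (i <= k)%N)
    (word3_red X (basisE C (Fidx v k)) (basisE C (Gidx c k))
     - word3_red X (basisE C (Gidx v k)) (basisE C (Fidx c k))
     + word3_red X (basisE C (Gidx c k)) (basisE C (Fidx v k))
     - word3_red X (basisE C (Fidx c k)) (basisE C (Gidx v k)))
  = (2 * ((n - i + 1)%:R - s)) *: (Rmx X v c - Rmx X c v).
Proof.
move=> le_in sX hX vi ci.
pose Z (u t k : 'I_n) := X (lshift n u) (lshift n k) *: basisE C (Gidx t k)
     - X (lshift n u) (rshift n k) *: basisE C (Fidx t k).
transitivity (\sum_(k < n | (i <= k)%N) (2 *: (Rmx X v c - Rmx X c v)
    + (2 * (1 - s)) *: (Z v c k - Z c v k))).
  apply: eq_bigr => k ik.
  rewrite /word3_red !chiM_ad_F // !chiM_ad_G // !adad_FG // !adad_GF // /Z.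
  move: (Rmx X v c) (Rmx X c v) (basisE C _) (basisE C _) (basisE C _) (basisE C _).
  by move=> R1 R2 M1 M2 M3 M4; apply/matrixP => x y; rewrite !mxE; ring.
have sum_const M : \sum_(k < n | (i <= k)%N) M = M *+ (n - i).
  by transitivity (\sum_(i <= k < n) M); [rewrite big_geq_mkord|exact: sumr_const_nat].
rewrite big_split /= sum_const -scaler_sumr sumrB -!Rmx_expand //.
by rewrite -scaler_nat scalerA -scalerDl natrD; congr (_ *: _); ring.
Qed.

Lemma omega_red_deg1 b (Y : tens C n) : (i <= n)%N -> gl_supp i Y -> deg i b = 1 ->
  omega_red b Y = (8 * (n.*2.+2)%:R)^-1 *:
    \sum_(v < n | (v < i)%N) \sum_(c < n | (c < i)%N) eta Y v c *:
      ((2 * ((n - i + 1)%:R - s)) *: (Rmx (basisE C b) v c - Rmx (basisE C b) c v)).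
Proof.
move=> le_in sY db.
rewrite /omega_red (sum_omega2 (fun p q => word3_red (basisE C b) (basisE C p) (basisE C q))) //.
congr (_ *: _); apply: eq_bigr => v vi; apply: eq_bigr => c ci; congr (_ *: _).
rewrite sum_word3_red //; first exact: sympl_basisE.
by have := graded_basisE C i b; rewrite db.
Qed.

Lemma word3_red_deg2 b p q : deg i b = 2 -> deg i p = -1 -> deg i q = -1 ->
  word3_red (basisE C b) (basisE C p) (basisE C q)
  = ad (ad (basisE C b) (basisE C p)) (basisE C q).
Proof.
move=> db dp dq; have chi0 r : deg i r = -1 -> chiM (ad (basisE C b) (basisE C r)) = 0.
  move=> dr; apply: (chiM_graded (graded_ad (graded_basisE C i b) (graded_basisE C i r))).
  by rewrite db dr.
by rewrite /word3_red !chi0 // !scale0r !addr0.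
Qed.

(** For fixed v, c, k the four words contribute 2 s times the difference of the (c, v) and (v, c)
    entries of the upper right block of X, which is symmetric. This holds for every s. *)
Lemma chiM_omega_red_deg2 b (Y : tens C n) : gl_supp i Y -> deg i b = 2 ->
  chiM (omega_red b Y) = 0.
Proof.
move=> sY db; set X := basisE C b.
have sX : sympl X by exact: sympl_basisE.
rewrite /omega_red (sum_omega2 (fun p q => word3_red X (basisE C p) (basisE C q))) // chiMZ.
rewrite chiM_sum big1 ?mulr0 // => v vi; rewrite chiM_sum big1 // => c ci.
rewrite chiMZ chiM_sum big1 ?mulr0 // => k ik.
have entF (u t : 'I_n) : (u < i)%N -> (t < i)%N ->
    ad X (basisE C (Fidx u k)) (lshift n t) (rshift n k) = - X (lshift n t) (rshift n u).
  move=> ui ti; rewrite basisE_FidxE /ad mulmxBr mulmxBl.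
  have entry (K L M N : 'M[C]_(n + n)) x y :
    (K - L - (M - N)) x y = K x y - L x y - (M x y - N x y) by rewrite !mxE.
  rewrite entry !mulmx_delta_entry !delta_mulmx_entry eqxx eq_rlshift eq_lrshift eq_lshift.
  by rewrite (lt_neq ti ik) !mulr0n mulr1n; ring.
have entG (u t : 'I_n) : (u < i)%N -> (t < i)%N ->
    ad X (basisE C (Gidx u k)) (lshift n t) (lshift n k) = X (lshift n t) (rshift n u).
  move=> ui ti; rewrite basisE_GidxE ?(leq_trans ui) // /ad mulmxDr mulmxDl.
  have entry (K L M N : 'M[C]_(n + n)) x y :
    (K + L - (M + N)) x y = K x y + L x y - (M x y + N x y) by rewrite !mxE.
  rewrite entry !mulmx_delta_entry !delta_mulmx_entry eqxx !eq_lrshift eq_lshift.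
  by rewrite eq_sym (lt_neq ui ik) !mulr0n mulr1n; ring.
rewrite /X !word3_red_deg2 ?deg_Fidx ?deg_Gidx // -/X -!scaleN1r 3!chiMD !chiMZ.
rewrite !chiM_ad_F // !chiM_ad_G // !entF // !entG // (symplLR c v sX).
by ring.
Qed.

Lemma deg_ge1 b : 1 <= deg i b -> deg i b = 1 \/ deg i b = 2.
Proof.
rewrite degE; case: b => [[j k]|[t|t]]; case: (_ < i)%N; case: (_ < i)%N => //; by [left|right].
Qed.

Lemma inJ_lmulT_critical b (Y : tens C n) : (i <= n)%N -> gl_supp i Y -> 1 <= deg i b ->
  s = (n - i + 1)%:R -> inJ i s (fun w => lmulT b (omega2 i Y) w).
Proof.
move=> le_in sY db es.
suff JT : inJ i s (fun w => \sum_r coordE (omega_red b Y) r * (w == [:: r])%:R).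
  by apply: Jext (JD (inJ_lmulT_omega2 Y db) JT) _ => w; rewrite subrK.
case: (deg_ge1 db) => d.
  have -> : omega_red b Y = 0.
    rewrite omega_red_deg1 // -es subrr mulr0 big1 ?scaler0 // => v _.
    by rewrite big1 // => c _; rewrite scale0r scaler0.
  by apply: Jext (J0 n i s) _ => w; rewrite big1 // => r _; rewrite coordE0 mul0r.
(* For b in g(2) the remainder lies in l, so it acts on the generator through the character. *)
have h : graded i 0 (omega_red b Y).
  apply: graded_sum => p _; apply: graded_sum => q _.
  have [->|/omega2_supp[dp dq]] := eqVneq (omega2 i Y [:: p; q]) 0.
    by rewrite scale0r; apply: graded0.
  rewrite word3_red_deg2 //; apply: graded_scale.
  have -> : 0 = deg i b + deg i p + deg i q by rewrite d dp dq.
  by apply: graded_ad; [apply: graded_ad|]; apply: graded_basisE.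
apply: Jext (inJ_parabolic [::] h (lexx 0)) _ => w.
by rewrite chiM_omega_red_deg2 // mul0r subr0.
Qed.

End Verma.

(** * Twisted vector fields on a chart of the Grassmannian *)

Section VectorFields.
Variables (C : numClosedFieldType) (n i : nat) (s : C).
Implicit Types (X Y : 'M[C]_(n + n)) (x y : 'I_(n + n)) (b : bidx n).

Local Notation pairs := ('I_(n + n) * 'I_(n + n))%type.
(** An abstract polynomial ring in the chart coordinates: constants, variables, partial derivatives
    and evaluation at the origin. [inJ_entry_eq0] supplies the actual polynomials. *)
Variables (A : comNzRingType) (k : {rmorphism C -> A}) (zvar : pairs -> A)
  (dvar : pairs -> A -> A) (ev : {rmorphism A -> C}).
Hypotheses (dvarD : forall u, {morph dvar u : f g / f + g})
  (dvarM : forall u f g, dvar u (f * g) = dvar u f * g + f * dvar u g)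
  (dvarC : forall u a, dvar u (k a) = 0)
  (dvar_zvar : forall u t, dvar u (zvar t) = (u == t)%:R)
  (dvar_comm : forall u t f, dvar u (dvar t f) = dvar t (dvar u f))
  (evC : forall a, ev (k a) = a) (ev_zvar : forall u, ev (zvar u) = 0).
Implicit Types (f g : A).

(** Marks the coordinate vectors that span the base point, the i-plane stable under q. *)
Definition top x := ht i x == 1.

(* The chart [1; Z] of the Grassmannian of i-planes, padded by zero columns to an
   idempotent matrix. *)
Definition chart : 'M[A]_(n + n) :=
  \matrix_(x, y) if top y then (if top x then (x == y)%:R else zvar (x, y)) else 0.

Definition topmx (R : pzRingType) : 'M[R]_(n + n) := \matrix_(x, y) ((x == y) && top x)%:R.

Definition cst X : 'M[A]_(n + n) := map_mx k X.

(** With U the chart, X moves U to first order by X U; subtracting U times the top block of X U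
    restores the identity block without moving the plane. *)
Definition vfield X : 'M[A]_(n + n) := cst X *m chart - chart *m cst X *m chart.

Definition lie X f : A := \sum_(u : pairs) vfield X u.1 u.2 * dvar u f.

Lemma topmx_mulE (R : pzRingType) (M : 'M[R]_(n + n)) x y :
  (topmx R *m M) x y = if top x then M x y else 0.
Proof.
rewrite mxE (bigD1 x) //= big1 ?addr0 => [|z ne]; last first.
  by rewrite mxE eq_sym (negbTE ne) mul0r.
by rewrite mxE eqxx /=; case: (top x); rewrite ?mul1r ?mul0r.
Qed.

Lemma mul_topmxE (R : pzRingType) (M : 'M[R]_(n + n)) x y :
  (M *m topmx R) x y = if top y then M x y else 0.
Proof.
rewrite mxE (bigD1 y) //= big1 ?addr0 => [|z ne]; last first.
  by rewrite mxE (negbTE ne) mulr0.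
by rewrite mxE eqxx /=; case: (top y); rewrite ?mulr1 ?mulr0.
Qed.

Lemma chart_topmx : chart *m topmx A = chart.
Proof. by apply/matrixP => x y; rewrite mul_topmxE !mxE; case: (top y). Qed.

Lemma topmx_chart : topmx A *m chart = topmx A.
Proof.
apply/matrixP => x y; rewrite topmx_mulE !mxE.
by case tx: (top x); rewrite ?andbT ?andbF //; case: eqP => [<-|]; rewrite ?tx ?if_same.
Qed.

Lemma lieD X : {morph lie X : f g / f + g}.
Proof.
move=> f g; rewrite /lie -big_split; apply: eq_bigr => u _.
by rewrite dvarD mulrDr.
Qed.

Lemma lieM X f g : lie X (f * g) = lie X f * g + f * lie X g.
Proof.
rewrite /lie mulr_suml mulr_sumr -big_split; apply: eq_bigr => u _.
by rewrite /= dvarM mulrDr mulrA mulrCA.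
Qed.

Lemma lieC X (a : C) : lie X (k a) = 0.
Proof. by rewrite /lie big1 // => u _; rewrite dvarC mulr0. Qed.

Lemma lie0 X : lie X 0 = 0.
Proof. by have := lieC X 0; rewrite rmorph0. Qed.

Lemma lie_nat X m : lie X m%:R = 0.
Proof. by rewrite -(rmorph_nat k) lieC. Qed.

Lemma lieN X f : lie X (- f) = - lie X f.
Proof. by apply/eqP; rewrite -addr_eq0 -lieD addNr lie0. Qed.

Lemma lie_sum X (I : Type) (r : seq I) (P : pred I) (F : I -> A) :
  lie X (\sum_(j <- r | P j) F j) = \sum_(j <- r | P j) lie X (F j).
Proof. exact: (big_morph (lie X) (lieD X) (lie0 X)). Qed.

Lemma lie_zvar X u : lie X (zvar u) = vfield X u.1 u.2.
Proof.
rewrite /lie (bigD1 u) //= big1 ?addr0 => [|t ne]; rewrite dvar_zvar.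
  by rewrite eqxx mulr1.
by rewrite (negbTE ne) mulr0.
Qed.

Lemma lie_mulmx X (M N : 'M[A]_(n + n)) :
  map_mx (lie X) (M *m N) = map_mx (lie X) M *m N + M *m map_mx (lie X) N.
Proof.
apply/matrixP => x y; rewrite !mxE lie_sum -big_split; apply: eq_bigr => z _.
by rewrite lieM !mxE.
Qed.

Lemma lie_cst X Y : map_mx (lie X) (cst Y) = 0.
Proof. by apply/matrixP => x y; rewrite !mxE lieC. Qed.

Lemma lie_topmx X : map_mx (lie X) (topmx A) = 0.
Proof. by apply/matrixP => x y; rewrite !mxE lie_nat. Qed.

Lemma lie_chart X : map_mx (lie X) chart = vfield X.
Proof.
apply/matrixP => x y; rewrite [LHS]mxE [X in lie _ X]mxE.
case ty: (top y); last first.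
  rewrite lie0 /vfield -mulmxA -[cst X *m chart]mulmx1 -!mulmxA.
  have z (M : 'M[A]_(n + n)) : (M *m chart) x y = 0.
    by rewrite -chart_topmx mulmxA mul_topmxE ty.
  by rewrite mulmx1 mulmxA mxE z [X in 0 + X]mxE z subr0.
case tx: (top x); last by rewrite lie_zvar.
have: (topmx A *m vfield X) x y = 0.
  by rewrite mulmxBr !mulmxA topmx_chart subrr mxE.
by rewrite topmx_mulE tx => ->; rewrite lie_nat.
Qed.

Lemma cst_mul X Y : cst (X *m Y) = cst X *m cst Y.
Proof. exact: map_mxM. Qed.

Lemma lie_vfieldE X Y : map_mx (lie Y) (vfield X) =
  cst X *m vfield Y - (vfield Y *m cst X *m chart + chart *m cst X *m vfield Y).
Proof.
have lieB (M N : 'M[A]_(n + n)) :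
    map_mx (lie Y) (M - N) = map_mx (lie Y) M - map_mx (lie Y) N.
  by apply/matrixP => x y; rewrite !mxE lieD lieN.
rewrite [in LHS]/vfield lieB; congr (_ - _).
  by rewrite lie_mulmx lie_cst mul0mx add0r lie_chart.
by rewrite lie_mulmx lie_mulmx lie_cst mulmx0 addr0 lie_chart.
Qed.

(** Products with a factor u between a and b occur in combinations symmetric in a and b, which
    cancel. *)
Lemma bracket_identity (R : comNzRingType) m (a b u : 'M[R]_m)
    (V := fun x : 'M[R]_m => x *m u - u *m x *m u) :
  (a *m V b - (V b *m a *m u + u *m a *m V b)) - (b *m V a - (V a *m b *m u + u *m b *m V a))
  = V (a *m b - b *m a).
Proof.
rewrite /V !(mulmxBl, mulmxBr) !mulmxA.
move: (a *m b *m u) (b *m a *m u) (a *m u *m b *m u) (b *m u *m a *m u).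
move: (u *m a *m b *m u) (u *m b *m a *m u) (u *m a *m u *m b *m u) (u *m b *m u *m a *m u).
move=> p1 p2 p3 p4 p5 p6 p7 p8; apply/matrixP => x y; rewrite !mxE; ring.
Qed.

Lemma cstD X Y : cst (X + Y) = cst X + cst Y.
Proof. by apply/matrixP => x y; rewrite !mxE raddfD. Qed.

Lemma cstB X Y : cst (X - Y) = cst X - cst Y.
Proof. by apply/matrixP => x y; rewrite !mxE raddfB. Qed.

Lemma cstZ (a : C) X : cst (a *: X) = k a *: cst X.
Proof. by apply/matrixP => x y; rewrite !mxE rmorphM. Qed.

Lemma vfieldD X Y : vfield (X + Y) = vfield X + vfield Y.
Proof. by rewrite /vfield cstD mulmxDl mulmxDr mulmxDl opprD addrACA. Qed.

Lemma vfieldZ (a : C) X : vfield (a *: X) = k a *: vfield X.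
Proof. by rewrite /vfield cstZ -scalemxAl -scalemxAr -scalemxAl scalerBr. Qed.

Lemma vfieldE X : vfield X = cst X *m chart - chart *m cst X *m chart.
Proof. by []. Qed.

Lemma lieE X f : lie X f = \sum_(u : pairs) vfield X u.1 u.2 * dvar u f.
Proof. by []. Qed.

Lemma ev_chart : map_mx ev chart = topmx C.
Proof.
apply/matrixP => x y; rewrite !mxE; case ty: (top y); last first.
  by rewrite rmorph0; case: eqP => [->|]; rewrite ?ty.
case tx: (top x); first by rewrite rmorph_nat andbT.
by rewrite ev_zvar andbF.
Qed.

Lemma ev_cst X : map_mx ev (cst X) = X.
Proof. by apply/matrixP => x y; rewrite !mxE evC. Qed.

Lemma vfield_ad X Y :
  map_mx (lie Y) (vfield X) - map_mx (lie X) (vfield Y) = vfield (ad X Y).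
Proof.
rewrite (lie_vfieldE X Y) (lie_vfieldE Y X) !vfieldE /ad cstB (cst_mul X Y) (cst_mul Y X).
exact: (bracket_identity (cst X) (cst Y) chart).
Qed.

(** Second derivatives commute, which leaves the bracket of the fields. The order is reversed, so
    [lie] is an anti-representation; accordingly [act] lets the first letter of a word act first and
    the last letter meets the evaluation. *)
Lemma lie_comm X Y f : lie Y (lie X f) - lie X (lie Y f) = lie (ad X Y) f.
Proof.
have expand (Z T : 'M[C]_(n + n)) : lie T (lie Z f) =
    \sum_(u : pairs) lie T (vfield Z u.1 u.2) * dvar u f
  + \sum_(u : pairs) \sum_(t : pairs)
      vfield Z u.1 u.2 * (vfield T t.1 t.2 * dvar t (dvar u f)).
  rewrite [lie Z f]lieE lie_sum -big_split; apply: eq_bigr => u _.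
  by rewrite lieM; congr (_ + _); rewrite lieE mulr_sumr.
rewrite (expand X Y) (expand Y X) [X in _ - (_ + X)]exchange_big /=.
rewrite [X in _ - (_ + X)](eq_bigr (fun u : pairs => \sum_(t : pairs)
      vfield X u.1 u.2 * (vfield Y t.1 t.2 * dvar t (dvar u f)))) => [|u _]; last first.
  apply: eq_bigr => t _; rewrite mulrCA; congr (_ * (_ * _)).
  exact: dvar_comm.
rewrite opprD addrACA subrr addr0 -sumrB lieE; apply: eq_bigr => u _.
rewrite -mulrBl -vfield_ad; congr (_ * _).
have entry (M N : 'M[A]_(n + n)) x y : (M - N) x y = M x y - N x y by rewrite !mxE.
by rewrite [RHS]entry [X in _ = X - _]mxE [X in _ = _ - X]mxE.
Qed.

(** The infinitesimal multiplier of the determinant of the i-plane: the trace of the block by which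
    [vfield] renormalises. *)
Definition mult X : A := \tr (topmx A *m cst X *m chart).

Lemma lie_mult X Y : lie Y (mult X) = \tr (topmx A *m cst X *m vfield Y).
Proof.
have -> : lie Y (mult X) = \tr (map_mx (lie Y) (topmx A *m cst X *m chart)).
  by rewrite /mult /mxtrace lie_sum; apply: eq_bigr => x _; rewrite [RHS]mxE.
by rewrite !lie_mulmx lie_topmx lie_cst lie_chart mul0mx mulmx0 addr0 mul0mx add0r.
Qed.

(** The cocycle identity that keeps [twist] an anti-representation for every s. *)
Lemma lie_mult_comm X Y : lie Y (mult X) - lie X (mult Y) = mult (ad X Y).
Proof.
have sym (Z T : 'M[C]_(n + n)) : \tr (topmx A *m cst Z *m (chart *m cst T *m chart))
    = \tr (chart *m cst Z *m (chart *m cst T)).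
  transitivity (\tr (chart *m (topmx A *m cst Z *m (chart *m cst T)))).
    by rewrite [RHS]mxtrace_mulC !mulmxA.
  by rewrite !mulmxA chart_topmx.
rewrite !lie_mult !vfieldE !mulmxBr ![\tr (_ - _)]raddfB /= !sym.
rewrite [\tr (chart *m cst Y *m _)]mxtrace_mulC opprB addrA subrK.
rewrite /mult cstB !cst_mul mulmxBr mulmxBl raddfB /=.
by rewrite !mulmxA.
Qed.

Lemma multD X Y : mult (X + Y) = mult X + mult Y.
Proof. by rewrite /mult cstD mulmxDr mulmxDl mxtraceD. Qed.

Lemma multZ (a : C) X : mult (a *: X) = k a * mult X.
Proof. by rewrite /mult cstZ -scalemxAr -scalemxAl mxtraceZ. Qed.

Definition twist X f : A := lie X f - k s * (mult X * f).

Lemma twist_comm X Y f : twist Y (twist X f) - twist X (twist Y f) = twist (ad X Y) f.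
Proof.
rewrite /twist !lieD !lieN !lieM !lieC -lie_comm -lie_mult_comm.
move: (lie Y (lie X f)) (lie X (lie Y f)) (lie X f) (lie Y f) (lie X (mult Y)) (lie Y (mult X)).
move: (mult X) (mult Y) (k s) => a b c d e g h l m.
by ring.
Qed.

Lemma twistD X f g : twist X (f + g) = twist X f + twist X g.
Proof. by rewrite /twist lieD !mulrDr opprD addrACA. Qed.

Lemma twistZ X (a : C) f : twist X (k a * f) = k a * twist X f.
Proof.
rewrite /twist lieM lieC mul0r add0r mulrBr; congr (_ - _).
by move: (mult X) (k s) (k a) => x y z; ring.
Qed.

Lemma twistDl X Y f : twist (X + Y) f = twist X f + twist Y f.
Proof.
rewrite /twist multD mulrDl mulrDr opprD addrACA; congr (_ + _).
rewrite !lieE -big_split; apply: eq_bigr => u _ /=.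
by rewrite vfieldD mxE mulrDl.
Qed.

Lemma twistZl (a : C) X f : twist (a *: X) f = k a * twist X f.
Proof.
rewrite /twist multZ mulrBr; congr (_ - _); last first.
  by rewrite -mulrA mulrCA.
rewrite !lieE mulr_sumr; apply: eq_bigr => u _ /=.
by rewrite vfieldZ mxE mulrA.
Qed.

Lemma twist0l f : twist 0 f = 0.
Proof. by have := twistZl 0 0 f; rewrite scale0r rmorph0 mul0r. Qed.

Lemma twist_suml (I : Type) (r : seq I) (P : pred I) (F : I -> 'M[C]_(n + n)) f :
  twist (\sum_(j <- r | P j) F j) f = \sum_(j <- r | P j) twist (F j) f.
Proof.
exact: (big_morph (fun X => twist X f) (fun X Y => twistDl X Y f) (twist0l f)).
Qed.

Definition act (w : seq (bidx n)) f : A := foldl (fun g b => twist (basisE C b) g) f w.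

Lemma actD w f g : act w (f + g) = act w f + act w g.
Proof. by elim: w f g => //= b w IH f g; rewrite twistD IH. Qed.

Lemma actZ w (a : C) f : act w (k a * f) = k a * act w f.
Proof. by elim: w f => //= b w IH f; rewrite twistZ IH. Qed.

Lemma act0 w : act w 0 = 0.
Proof. by have := actZ w 0 0; rewrite rmorph0 !mul0r. Qed.

Lemma act_sum w (I : Type) (r : seq I) (P : pred I) (F : I -> A) :
  act w (\sum_(j <- r | P j) F j) = \sum_(j <- r | P j) act w (F j).
Proof. exact: (big_morph (act w) (actD w) (act0 w)). Qed.

Lemma act_cat w1 w2 f : act (w1 ++ w2) f = act w2 (act w1 f).
Proof. exact: foldl_cat. Qed.

Lemma act_lie (a w : seq (bidx n)) p q f :
  act (a ++ p :: q :: w) f - act (a ++ q :: p :: w) f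
  = \sum_r k (coordE (ad (basisE C p) (basisE C q)) r) * act (a ++ r :: w) f.
Proof.
rewrite !act_cat /=; set g := act a f.
have actB h h' : act w h - act w h' = act w (h - h').
  by rewrite actD -[- h']mulN1r -(rmorphN1 k) actZ rmorphN1 mulN1r.
rewrite actB twist_comm {1}(sympl_expand (sympl_ad (sympl_basisE C p) (sympl_basisE C q))).
rewrite twist_suml act_sum; apply: eq_bigr => r _.
by rewrite twistZl actZ act_cat.
Qed.

Lemma ev_vfield X x y : ev (vfield X x y) = if top y && ~~ top x then X x y else 0.
Proof.
have -> : ev (vfield X x y) = map_mx ev (vfield X) x y by rewrite [RHS]mxE.
rewrite vfieldE map_mxB !map_mxM /= ev_cst ev_chart.
have entry (M N : 'M[C]_(n + n)) : (M - N) x y = M x y - N x y by rewrite !mxE.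
rewrite entry !mul_topmxE topmx_mulE.
by case: (top y); case: (top x); rewrite ?subrr ?subr0.
Qed.

Lemma ev_mult X : ev (mult X) = \sum_(j < n | (j < i)%N) X (lshift n j) (lshift n j).
Proof.
have -> : ev (mult X) = \tr (map_mx ev (topmx A *m cst X *m chart)).
  by rewrite /mult /mxtrace rmorph_sum; apply: eq_bigr => x _; rewrite [RHS]mxE.
rewrite !map_mxM /= ev_cst ev_chart (_ : map_mx _ (topmx A) = topmx C); last first.
  by apply/matrixP => x y; rewrite !mxE rmorph_nat.
rewrite /mxtrace big_split_ord /= [X in _ + X]big1 ?addr0 => [|j _]; last first.
  by rewrite mul_topmxE /top htR; case: (_ < _)%N.
rewrite [RHS]big_mkcond; apply: eq_bigr => j _.
by rewrite mul_topmxE topmx_mulE /top htL; case: (_ < _)%N.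
Qed.

(** A field from q vanishes at the base point, so only the multiplier is left there. *)
Lemma ev_twist_parabolic d X f : graded i d X -> 0 <= d -> ev (twist X f) = chiM i s X * ev f.
Proof.
move=> hX d0; rewrite rmorphB !rmorphM /= evC ev_mult.
rewrite lieE rmorph_sum big1 ?sub0r => [|u _]; first by rewrite /chiM !mulNr mulrA.
rewrite rmorphM /= ev_vfield; case: ifP => [/andP[/eqP t1 t0]|_]; last by rewrite mul0r.
rewrite (graded_eq0 hX) ?mul0r //; apply: contraTneq d0 => <-; rewrite t1.
move: t0; rewrite /top; case: (split_ordP u.1) => j ->; rewrite ?htL ?htR; by case: (_ < _)%N.
Qed.

Lemma ev_twist_zvar X x y : ~~ top x -> top y -> ev (twist X (zvar (x, y))) = X x y.
Proof.
move=> tx ty; rewrite rmorphB !rmorphM /= lie_zvar ev_vfield /= ty tx.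
by rewrite ev_zvar !mulr0 subr0.
Qed.

(** * Linear forms on words that vanish on J_s *)

Lemma inJ_sum_eq0 (phi : seq (bidx n) -> C) :
  (forall (a w : seq (bidx n)) p q, phi (a ++ p :: q :: w) - phi (a ++ q :: p :: w)
     = \sum_r coordE (ad (basisE C p) (basisE C q)) r * phi (a ++ r :: w)) ->
  (forall a p, 0 <= deg i p -> phi (rcons a p) = chi i s p * phi a) ->
  forall h : talg C n, inJ i s h -> exists N0, forall N, (N0 <= N)%N ->
    \sum_(m < N) \sum_(t : m.-tuple (bidx n)) h t * phi t = 0.
Proof.
move=> phi_lie phi_q h.
(* Elements of [talg] are arbitrary functions on words, so the pairing is cut off at word length N;
   each element of J_s is supported on words of bounded length and is fully seen once N is large. *)
pose pairing N (h : talg C n) := \sum_(m < N) \sum_(t : m.-tuple (bidx n)) h t * phi t.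
have pairing_word N u : (size u < N)%N -> pairing N (fun w => (w == u)%:R) = phi u.
  move=> uN; rewrite /pairing (bigD1 (Ordinal uN)) //= (bigD1 (in_tuple u)) //= eqxx mul1r.
  rewrite !big1 ?addr0 // => [m ne|t ne].
    rewrite big1 // => t _; case: eqP => [e|_]; last by rewrite mul0r.
    by case/eqP: ne; apply: val_inj; rewrite /= -e size_tuple.
  by rewrite -val_eqE /= in ne; rewrite (negbTE ne) mul0r.
have pairingD N h1 h2 : pairing N (fun w => h1 w + h2 w) = pairing N h1 + pairing N h2.
  rewrite /pairing -big_split; apply: eq_bigr => m _ /=.
  by rewrite -big_split; apply: eq_bigr => t _ /=; rewrite mulrDl.
have pairingZ N a h1 : pairing N (fun w => a * h1 w) = a * pairing N h1.
  rewrite /pairing mulr_sumr; apply: eq_bigr => m _ /=.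
  by rewrite mulr_sumr; apply: eq_bigr => t _ /=; rewrite mulrA.
have pairing_ext N h1 h2 : (forall w, h1 w = h2 w) -> pairing N h1 = pairing N h2.
  by move=> e; apply: eq_bigr => m _; apply: eq_bigr => t _; rewrite e.
have pairing_sum N (a : bidx n -> C) (H : bidx n -> talg C n) :
    pairing N (fun w => \sum_r a r * H r w) = \sum_r a r * pairing N (H r).
  transitivity (\sum_r pairing N (fun w => a r * H r w)).
    rewrite /pairing [RHS]exchange_big; apply: eq_bigr => m _ /=.
    by rewrite [RHS]exchange_big; apply: eq_bigr => t _ /=; rewrite mulr_suml.
  by apply: eq_bigr => r _; rewrite pairingZ.
change (inJ i s h -> exists N0, forall N, (N0 <= N)%N -> pairing N h = 0).
elim=> {h} [|h1 h2 _ [N1 e1] _ [N2 e2]|a h _ [N1 e1]|h1 h2 _ [N1 e1] e|a w p q|a p dp].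
- by exists 0%N => N _; rewrite /pairing big1 // => m _; rewrite big1 // => t _; rewrite mul0r.
- exists (maxn N1 N2) => N; rewrite geq_max => /andP[l1 l2].
  rewrite pairingD -[RHS]addr0; congr (_ + _); [exact: e1|exact: e2].
- by exists N1 => N l1; rewrite pairingZ e1 // mulr0.
- by exists N1 => N l1; rewrite -(pairing_ext N _ _ e); apply: e1.
- exists (size (a ++ p :: q :: w)).+1 => N lN.
  have sz r : (size (a ++ r :: w) < N)%N.
    by apply: leq_ltn_trans lN; rewrite !size_cat /= !addnS leqW.
  have szqp : (size (a ++ q :: p :: w) < N)%N by move: lN; rewrite !size_cat.
  rewrite (pairing_ext N _ (fun w' => ((w' == a ++ p :: q :: w)%:R
      + -1 * (w' == a ++ q :: p :: w)%:R) + -1 * (\sum_r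
        coordE (ad (basisE C p) (basisE C q)) r * (w' == a ++ r :: w)%:R))); last first.
    by move=> w'; rewrite !mulN1r.
  rewrite pairingD pairingD !pairingZ pairing_sum !pairing_word // !mulN1r phi_lie.
  by apply/eqP; rewrite subr_eq0; apply/eqP; apply: eq_bigr => r _; rewrite pairing_word.
- exists (size a).+2 => N lN.
  rewrite (pairing_ext N _ (fun w => (w == rcons a p)%:R + (- chi i s p) * (w == a)%:R)); last first.
    by move=> w; rewrite mulNr.
  rewrite pairingD pairingZ !pairing_word ?size_rcons ?(ltnW lN) // phi_q //.
  by rewrite mulNr subrr.
Qed.

(** The form built from the coordinate function at (x, y) sends a one-letter word to the (x, y)
    entry of its basis vector, because that function vanishes at the base point and the multiplier
    drops out. *)
Lemma inJ_vfield_entry_eq0 (T : 'M[C]_(n + n)) x y : sympl T -> ~~ top x -> top y ->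
  inJ i s (fun w => \sum_r coordE T r * (w == [:: r])%:R) -> T x y = 0.
Proof.
move=> sT tx ty.
pose phi w := ev (act w (zvar (x, y))).
case/(inJ_sum_eq0 (phi := phi)) => [a w p q|a p dp|N0 H].
- rewrite /phi -rmorphB act_lie rmorph_sum; apply: eq_bigr => r _.
  by rewrite rmorphM /= evC.
- rewrite /phi -cats1 act_cat (ev_twist_parabolic _ (graded_basisE C i p) dp).
  congr (_ * _); rewrite -sum_coordE_chi (bigD1 p) //= big1 ?addr0 => [|r ne].
    by rewrite coordE_basisE eqxx mul1r.
  by rewrite coordE_basisE eq_sym (negbTE ne) mul0r.
(* The bound 2 ensures that words of length 1 are counted. *)
have := H (maxn N0 2) (leq_maxl _ _); move: (leq_maxr N0 2); set N := maxn N0 2 => lN.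
rewrite (bigD1 (Ordinal lN)) //= [X in _ + X]big1 ?addr0 => [|m ne]; last first.
  rewrite big1 // => t _; rewrite big1 ?mul0r // => r _; case: eqP => [e|_]; last by rewrite mulr0.
  by case/eqP: ne; apply: val_inj; rewrite /= -(size_tuple t) e.
move=> <-; rewrite {1}(sympl_expand sT) summxE.
under [RHS]eq_bigr => t _ do rewrite mulr_suml.
rewrite [RHS]exchange_big; apply: eq_bigr => r _ /=.
rewrite (bigD1 [tuple r]) //= eqxx mulr1 big1 ?addr0 => [|t ne].
  by rewrite /phi /= (ev_twist_zvar _ tx ty) mxE.
by rewrite -val_eqE /= in ne; rewrite (negbTE ne) mulr0 mul0r.
Qed.

End VectorFields.

Lemma inJ_entry_eq0 (C : numClosedFieldType) (n i : nat) (s : C) (T : 'M[C]_(n + n)) x y :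
  sympl T -> ~~ top i x -> top i y ->
  inJ i s (fun w => \sum_r coordE T r * (w == [:: r])%:R) -> T x y = 0.
Proof.
pose N := #|{: 'I_(n + n) * 'I_(n + n)}|.
apply: (@inJ_vfield_entry_eq0 C n i s {mpoly C[N]} (@mpolyC N C)
  (fun u => 'X_(enum_rank u)) (fun u f => f^`M(enum_rank u)) (meval (fun _ => 0))).
- by move=> u f g; apply: mderivD.
- by move=> u f g; apply: mderivM.
- by move=> u a; apply: mderivC.
- move=> u t; rewrite mderivX mnmE (inj_eq enum_rank_inj) eq_sym; case: eqP => [->|_].
    by rewrite scale1r -{1}[U_(_)%MM]add0m addmK mpolyX0.
  by rewrite scale0r.
- by move=> u t f; apply: mderiv_comm.
- by move=> a; apply: mevalC.
- by move=> u; apply: mevalXU.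
Qed.

(** * An explicit lowest weight vector of W^* *)

Section LowestWeight.
Variables (C : numClosedFieldType) (n i : nat).
Implicit Types (Z M N : 'M[C]_(n + n)) (a v w j k : 'I_n) (p q r b : bidx n).

Local Notation E j k := (basisE C (inl (j, k))).
Local Notation D j k := (sdelta C (rshift n j) (lshift n k)).

(* Contracting the first index makes this transform under gl(i) like the tensor product
   of the dual basis vectors e_v^* and e_w^*; antisymmetrising in v, w lands in W^*. *)
Definition contr v w : tens C n :=
  fun p q => \sum_(a < n | (a < i)%N) coordE (E a v) p * coordE (D a w) q.

Lemma sdeltaRL_sym j k : D j k = D k j.
Proof. by rewrite !sdeltaRL addrC. Qed.

Lemma coordE_ad_expand Z M r : sympl M ->
  coordE (ad Z M) r = \sum_p coordE (ad Z (basisE C p)) r * coordE M p.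
Proof.
move=> sM; rewrite {1}(sympl_expand sM) linear_sum /= coordE_sum; apply: eq_bigr => p _.
by rewrite adZr coordEZ mulrC.
Qed.

Lemma actT_contr Z v w r q : actT Z (contr v w) r q =
  \sum_(a < n | (a < i)%N) (coordE (ad Z (E a v)) r * coordE (D a w) q
                          + coordE (E a v) r * coordE (ad Z (D a w)) q).
Proof.
rewrite /actT /contr big_split /=; congr (_ + _).
  under eq_bigr => p _ do rewrite mulr_sumr.
  rewrite exchange_big; apply: eq_bigr => a _ /=.
  rewrite (coordE_ad_expand _ _ (sympl_basisE C (inl (a, v)))) mulr_suml.
  by apply: eq_bigr => p _; rewrite mulrA.
under eq_bigr => p _ do rewrite mulr_sumr.
rewrite exchange_big; apply: eq_bigr => a _ /=.
rewrite (coordE_ad_expand _ _ (sympl_sdelta C _ _)) mulr_sumr.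
by apply: eq_bigr => p _; rewrite mulrCA.
Qed.

Lemma ad_EE j k a v : ad (E j k) (E a v) =
  (k == a)%:R *: E j v - (j == v)%:R *: E a k.
Proof.
rewrite /ad /basisE !mulmxBl !mulmxBr !mul_delta_mx_cond !eq_lshift !eq_rshift.
rewrite !eq_lrshift !eq_rlshift [v == j]eq_sym [a == k]eq_sym.
by case: (k == a); case: (j == v); rewrite ?mulr0n ?mulr1n ?scale0r ?scale1r;
  apply/matrixP => x y; rewrite !mxE; ring.
Qed.

Lemma ad_ED j k a w : ad (E j k) (D a w) =
  (- (j == a)%:R) *: D k w - (j == w)%:R *: D a k.
Proof.
rewrite !sdeltaRL /ad /basisE !mulmxBl !mulmxBr !mulmxDl !mulmxDr !mul_delta_mx_cond.
rewrite !(eq_lshift, eq_rshift, eq_lrshift, eq_rlshift) [a == j]eq_sym [w == j]eq_sym.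
by case: (j == a); case: (j == w);
  rewrite ?mulr0n ?mulr1n ?oppr0 ?scaleN1r ?scale0r ?scale1r;
  apply/matrixP => x y; rewrite !mxE; ring.
Qed.

Lemma ad_DE j k a v : (j == a) = false -> (k == a) = false -> ad (D j k) (E a v) = 0.
Proof.
move=> ja ka; rewrite !sdeltaRL /ad /basisE !mulmxBr !mulmxBl !mulmxDl !mulmxDr !mul_delta_mx_cond.
rewrite !(eq_lshift, eq_rshift, eq_lrshift, eq_rlshift) [a == j]eq_sym [a == k]eq_sym ja ka.
by rewrite !mulr0n !addr0 !subr0.
Qed.

Lemma ad_DD j k a w : ad (D j k) (D a w) = 0.
Proof.
rewrite !sdeltaRL /ad !mulmxDl !mulmxDr !mul_delta_mx_cond.
by rewrite !eq_lrshift !mulr0n !addr0 subr0.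
Qed.

Lemma sum_eq_cond j (F : 'I_n -> C) :
  \sum_(a < n | (a < i)%N) (j == a)%:R * F a = (j < i)%N%:R * F j.
Proof.
case ji: (j < i)%N.
  rewrite (bigD1 j) //= eqxx big1 ?addr0 // => a /andP[_ ne].
  by rewrite eq_sym (negbTE ne) mul0r.
rewrite mul0r big1 // => a ai; case: eqP => [e|_]; last by rewrite mul0r.
by rewrite e ai in ji.
Qed.

(** The two contributions through the summed index a cancel, as for a vector paired with its dual.
    The cancellation needs j and k on the same side of i. *)
Lemma actT_contr_E j k v w r q : (j < i)%N = (k < i)%N ->
  actT (E j k) (contr v w) r q
  = - ((j == v)%:R * contr k w r q) - (j == w)%:R * contr v k r q.
Proof.
move=> jk; rewrite actT_contr /contr !mulr_sumr.
transitivity (\sum_(a < n | (a < i)%N) (k == a)%:R * (coordE (E j v) r * coordE (D a w) q)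
  - \sum_(a < n | (a < i)%N) (j == a)%:R * (coordE (E a v) r * coordE (D k w) q)
  - \sum_(a < n | (a < i)%N) (j == v)%:R * (coordE (E a k) r * coordE (D a w) q)
  - \sum_(a < n | (a < i)%N) (j == w)%:R * (coordE (E a v) r * coordE (D a k) q)).
  rewrite -!sumrB; apply: eq_bigr => a ai.
  have cB (x y : C) M N p : coordE (x *: M - y *: N) p = x * coordE M p - y * coordE N p.
    by rewrite -[- _]scaleN1r coordED !coordEZ mulN1r.
  by rewrite ad_EE ad_ED !cB; ring.
rewrite sum_eq_cond (sum_eq_cond j (fun a => coordE (E a v) r * coordE (D k w) q)).
by rewrite jk subrr sub0r -!sumrN.
Qed.

Lemma graded_sdeltaRL j k : (j < i)%N -> (k < i)%N -> graded i (- 2) (D j k).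
Proof.
move=> ji ki; rewrite sdeltaRL; apply: graded_add.
  by have := @graded_delta C n i (rshift n j) (lshift n k); rewrite htR htL ji ki.
by have := @graded_delta C n i (rshift n k) (lshift n j); rewrite htR htL ji ki.
Qed.

Lemma contrE a u v w q :
  contr v w (inl (a, u)) q = if (a < i)%N && (v == u) then coordE (D a w) q else 0.
Proof.
transitivity (\sum_(c < n | (c < i)%N) (a == c)%:R * ((v == u)%:R * coordE (D c w) q)).
  apply: eq_bigr => c _; rewrite coordE_basisE mulrA -natrM mulnb; congr (_%:R * _).
  by rewrite [a == c]eq_sym.
by rewrite sum_eq_cond; case: (a < i)%N; case: (v == u); rewrite ?mul1r ?mul0r.
Qed.

Lemma contr_supp v w : (v < i)%N -> (w < i)%N -> gl_supp i (contr v w).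
Proof.
move=> vi wi p q; rewrite /contr big_mkcond => /sum_neq0[a]; case: ifP => ai; last by rewrite eqxx.
rewrite mulf_eq0 negb_or coordE_basisE => /andP[]; case: (inl (a, v) =P p) => [<- _ cq|_]; last by rewrite eqxx.
by split; [exact: coordE_graded (graded_sdeltaRL ai wi) cq|exists a, v].
Qed.

Definition lowest v w : tens C n := fun p q => contr v w p q - contr w v p q.

Lemma actT_lowest Z v w r q :
  actT Z (lowest v w) r q = actT Z (contr v w) r q - actT Z (contr w v) r q.
Proof.
rewrite /actT opprD addrACA -!sumrB.
by congr (_ + _); apply: eq_bigr => p _; rewrite mulrBr.
Qed.

Lemma lowest_lw v w : (v : nat) = 0%N -> (w : nat) = 1%N -> (1 < i)%N ->
  lw_vec i (lowest v w).
Proof.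
move=> v0 w1 i1; have vi : (v < i)%N by rewrite v0 ltnW.
have wi : (w < i)%N by rewrite w1.
split.
- move=> p q; rewrite /lowest; have [e|/(contr_supp vi wi) //] := eqVneq (contr v w p q) 0.
  by rewrite e sub0r oppr_eq0 => /(contr_supp wi vi).
- move=> q; rewrite /lowest sumrB.
  (* The trace of [contr u t] is symmetric in u and t, so antisymmetrisation removes it. *)
  have tr (u t : 'I_n) : (u < i)%N -> \sum_(j < n | (j < i)%N) contr u t (inl (j, j)) q = coordE (D u t) q.
    move=> ui; transitivity (\sum_(j < n | (j < i)%N) (u == j)%:R * coordE (D j t) q).
      by apply: eq_bigr => j ji; rewrite contrE ji /=; case: (u == j); rewrite ?mul1r ?mul0r.
    by rewrite sum_eq_cond ui mul1r.
  by rewrite !tr // sdeltaRL_sym subrr.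
- move=> j p q; rewrite actT_lowest !actT_contr_E // /lowest.
  have -> : ((j : nat) == 0%N) = (j == v) by rewrite -val_eqE /= v0.
  have -> : ((j : nat) == 1%N) = (j == w) by rewrite -val_eqE /= w1.
  case: (eqVneq j v) => [->|_]; case: (eqVneq _ w) => [->|_]; rewrite ?mulr0n ?mulr1n; ring.
move=> b /andP[/eqP db nb] p q; rewrite actT_lowest.
case: b db nb => [[j k]|[t|t]]; rewrite degE //= => db nb.
  have jk : (j < i)%N = (k < i)%N by move: db; case: (j < i)%N; case: (k < i)%N.
  rewrite !actT_contr_E //.
  (* With k < j only j = w, k = v can act, and it sends both halves of [lowest v w] to the same
     multiple of [contr v v]. *)
  have jv : (j == v) = false by rewrite -val_eqE /= v0 gtn_eqF // (leq_ltn_trans _ nb).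
  rewrite jv; case: (eqVneq j w) => [ej|_]; last by rewrite !mulr0n; ring.
  have -> : k = v by apply: val_inj; move: nb; rewrite /= v0 ej w1 ltnS leqn0 => /eqP.
  by rewrite mulr1n mulr0n; ring.
have no_act (a u c : 'I_n) : (a < i)%N -> ad (basisE C (inr (inr t))) (E a u) = 0
    /\ ad (basisE C (inr (inr t))) (D a c) = 0.
  have ge1 : (i <= (sval t).1)%N /\ (i <= (sval t).2)%N.
    by rewrite ![(i <= _)%N]leqNgt; move: db; case: (_ < i)%N; case: (_ < i)%N.
  case: ge1 => ge1 ge2 ai; rewrite basisE_sdelta; split; last exact: ad_DD.
  by apply: ad_DE; rewrite eq_sym (lt_neq (i := i)).
suff act0 (u c : 'I_n) : actT (basisE C (inr (inr t))) (contr u c) p q = 0 by rewrite !act0 subrr.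
rewrite actT_contr big1 // => a ai; have [-> ->] := no_act a u c ai.
by rewrite !coordE0 mul0r mulr0 addr0.
Qed.

(** When c = w every u < i contributes 1, and u = w contributes once more because [D w w] has the
    entry 2; hence i + 1. *)
Lemma eta_contr v w x c : (w < i)%N -> (i <= n)%N ->
  eta (contr v w) x c = ((v == x) && (c == w))%:R * (i.+1)%:R.
Proof.
move=> wi le_in; rewrite /eta.
transitivity (\sum_(u < n | (u < i)%N) (v == x)%:R * D u w (rshift n c) (lshift n u)).
  rewrite [RHS]big_mkcond; apply: eq_bigr => u _ /=.
  under eq_bigr => q _ do rewrite contrE.
  case: ifP => ui /=; last by rewrite big1 // => q _; rewrite mul0r.
  case: (v == x); last by rewrite mul0r big1 // => q _; rewrite mul0r.
  rewrite mul1r {2}(sympl_expand (sympl_sdelta C (rshift n u) (lshift n w))) summxE.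
  by apply: eq_bigr => q _; rewrite mxE.
rewrite -mulr_sumr -mulnb natrM -mulrA; congr (_ * _).
transitivity (\sum_(u < n | (u < i)%N) ((w == u)%:R * (c == u)%:R + (c == w)%:R : C)).
  apply: eq_bigr => u _; rewrite sdeltaRL !mxE !eq_rshift !eq_lshift eqxx andbT [u == w]eq_sym.
  by rewrite -mulnb natrM mulrC.
rewrite big_split /= sum_eq_cond wi mul1r sumr_const.
have -> : #|[pred u : 'I_n | (u < i)%N]| = i.
  transitivity (\sum_(u < n | (u < i)%N) 1)%N; first by rewrite sum1_card.
  by rewrite -(big_ord_widen n (fun=> 1%N) le_in) sum1_card card_ord.
by rewrite -mulrS mulr_natr.
Qed.

End LowestWeight.

(** * The equivalence *)

Lemma sympl_sum (C : numClosedFieldType) n (I : Type) (r : seq I) (P : pred I)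
    (F : I -> 'M[C]_(n + n)) :
  (forall j, P j -> sympl (F j)) -> sympl (\sum_(j <- r | P j) F j).
Proof.
move=> sF; apply: big_ind sF => [x y|M N]; last exact: sympl_add.
by rewrite !mxE mulr0 oppr0.
Qed.

Lemma sympl_omega_red (C : numClosedFieldType) (n i : nat) (s : C) b (Y : tens C n) :
  sympl (omega_red i s b Y).
Proof.
apply: sympl_sum => p _; apply: sympl_sum => q _; apply: sympl_scale.
have sb := @sympl_basisE C n.
by apply: sympl_add; [apply: sympl_add|]; try apply: sympl_scale; rewrite //; do 2?apply: sympl_ad.
Qed.

Theorem theorem5p8 (C : numClosedFieldType) (n i : nat) :
  (3 <= n)%N -> (2 <= i)%N -> (i <= n - 1)%N ->
  forall s : C, conf_invariant n i s <-> s = (n - i + 1)%:R.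
Proof.
move=> n3 i2 i_lt s.
have lt_in : (i < n)%N by rewrite -(subnK (ltnW (ltnW n3))) addn1 ltnS.
have le_in := ltnW lt_in; split=> [inv|es]; last first.
  move=> Y /inWdual_supp sY x x_supp; apply: inJ_sum => b _.
  have [e|/x_supp db] := eqVneq (x b) 0.
    by apply: Jext (J0 n i s) _ => w; rewrite e mul0r.
  exact/JZ/inJ_lmulT_critical.
pose o0 := Ordinal (ltnW (ltnW n3)); pose o1 := Ordinal (ltnW n3); pose oi := Ordinal lt_in.
have i1 : (0 < i)%N by exact: ltnW.
(* X has root e_1 - e_(i+1) and omega_2(Y) has weight -(e_1 + e_2), so the remainder lies in the
   root space of -(e_2 + e_(i+1)), which the entry tested below detects. *)
pose b : bidx n := inl (o0, oi); pose Y := lowest C i o0 o1.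
have lwY : lw_vec i Y by apply: lowest_lw.
have db : deg i b = 1 by rewrite degE /= i1 ltnn.
have sY : gl_supp i Y by case: lwY.
have JT : inJ i s (fun w => \sum_r coordE (omega_red i s b Y) r * (w == [:: r])%:R).
  have x_supp r : (r == b)%:R != 0 :> C -> 1 <= deg i r.
    by case: (r =P b) => [-> _|_]; [rewrite db|rewrite eqxx].
  have db1 : 1 <= deg i b by rewrite db.
  apply: Jext (JD (inv Y (Wd_lw lwY) _ x_supp) (JZ (-1) (inJ_lmulT_omega2 s Y db1))) _ => w.
  rewrite (bigD1 b) //= eqxx mul1r big1 => [|r ne]; last by rewrite (negbTE ne) mul0r.
  by rewrite addr0 mulN1r opprB addrC subrK.
have := inJ_entry_eq0 (x := rshift n oi) (y := lshift n o1) (sympl_omega_red i s b Y) _ _ JT.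
rewrite /top htR htL /= ltnn i2 => /(_ isT isT).
rewrite omega_red_deg1 //.
have Rent (v c : 'I_n) : (c < i)%N ->
    Rmx (basisE C b) v c (rshift n oi) (lshift n o1) = ((v == o0) && (c == o1))%:R.
  move=> ci; have entry (M N : 'M[C]_(n + n)) x y : (M - N) x y = M x y - N x y by rewrite !mxE.
  rewrite entry delta_mulmx_entry mulmx_delta_entry eq_rshift eq_lshift.
  rewrite [oi == c]eq_sym (lt_neq (i := i) (k := oi) ci (leqnn i)) mul0r sub0r !mxE.
  rewrite !(eq_lrshift, eq_rlshift, eq_rshift) eqxx /= sub0r mulNr opprK -natrM mulnb.
  by rewrite [o1 == c]eq_sym.
have etaY (v c : 'I_n) : eta Y v c =
    (((o0 == v) && (c == o1))%:R - ((o1 == v) && (c == o0))%:R) * (i.+1)%:R.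
  rewrite mulrBl -!eta_contr //; rewrite /eta -sumrB; apply: eq_bigr => u _.
  by rewrite -sumrB; apply: eq_bigr => q _; rewrite mulrBl.
have sum_pair (f : 'I_n -> 'I_n -> C) (v0 c0 : 'I_n) : (v0 < i)%N -> (c0 < i)%N ->
    \sum_(v < n | (v < i)%N) \sum_(c < n | (c < i)%N) f v c * ((v == v0) && (c == c0))%:R
    = f v0 c0.
  move=> v0i c0i; rewrite (bigD1 v0) //= (bigD1 c0) //= !eqxx mulr1.
  rewrite !big1 ?addr0 // => [v /andP[_ /negbTE ->]|c /andP[_ /negbTE ->]]; last by rewrite mulr0.
  by rewrite big1 // => c _; rewrite mulr0.
rewrite mxE summxE.
have -> : \sum_(v < n | (v < i)%N) (\sum_(c < n | (c < i)%N)
     eta Y v c *: ((2 * ((n - i + 1)%:R - s)) *: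
          (Rmx (basisE C b) v c - Rmx (basisE C b) c v))) (rshift n oi) (lshift n o1)
  = 2 * ((n - i + 1)%:R - s) * (eta Y o0 o1 - eta Y o1 o0).
  rewrite [RHS]mulrBr -(sum_pair (fun v c => _ * eta Y v c) o0 o1) //.
  rewrite -(sum_pair (fun v c => _ * eta Y v c) o1 o0) // -sumrB.
  apply: eq_bigr => v vi; rewrite summxE -sumrB; apply: eq_bigr => c ci.
  have entry (x y : C) (M N : 'M[C]_(n + n)) k l :
    (x *: (y *: (M - N))) k l = x * (y * (M k l - N k l)) by rewrite !mxE.
  by rewrite entry !Rent // [(c == o0) && _]andbC; ring.
rewrite !etaY !eqxx /= ?mulr0n ?mulr1n subr0 sub0r mul1r.
(* Antisymmetry of [Y] makes the two values of [eta] add up to 2 (i + 1), nonzero in characteristic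
   0, so the factor n - i + 1 - s has to vanish. *)
have -> : ((i.+1)%:R - (-1) * (i.+1)%:R : C) = (2 * i.+1)%:R by rewrite natrM; ring.
move/eqP; rewrite !mulf_eq0 invr_eq0 mulf_eq0 !pnatr_eq0 /= orbF subr_eq0.
by move/eqP.
Qed.
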